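(* Let $D$ be a digraph with $n$ vertices, let $\lambda$ be a partition of $n$, and let $Z_D=\sum_F p_{t(F)}$, the sum over all cycle covers $F$ of $D$. (1) The coefficient of $(-1)^{n-\ell(\lambda)}e_\lambda$ in $Z_D$ is the number of ordered pairs $(E,F)$ where $E$ is a path cover of $D$ of type $\lambda$ and $F$ is a cycle cover of $D/E$. (2) The coefficient of $h_\lambda$ in $Z_D$ is \[ \sum_{E}\det(D/E), \] the sum over all path covers $E$ of $D$ of type $\lambda$, where $\det(D/E)$ is the determinant of the adjacency matrix of $D/E$.
   Context: A digraph has a finite vertex set $V$ and arrow set a subset of $V\times V$ (loops allowed, no multiple arrows). Paths and cycles on $D$ are subdigraphs that are directed paths/cycles using no vertex twice; a path may be a single vertex, a cycle may be a loop. A path cover (resp. cycle cover) of $D$ is a spanning subdigraph that is a disjoint union of paths (resp. cycles) on $D$ with every vertex in exactly one of them. The type $t(E)$ of a digraph is the partition of component sizes; $\ell(\lambda)$ is the number of parts of $\lambda$. For a path cover $E$ of $D$, $D/E$ is the digraph whose vertices are the components (paths) of $E$, with an arrow from $v$ to $w$ (possibly $v=w$, a loop) iff $D$ has an arrow from the last vertex of path $v$ to the first vertex of path $w$. The adjacency matrix has $(i,j)$ entry $1$ if there is an arrow from vertex $i$ to vertex $j$ and $0$ otherwise (rows and columns indexed by the same ordering). $p_\lambda,e_\lambda,h_\lambda$ are the power sum, elementary and complete homogeneous symmetric functions. *)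

(* Defs.v *)
From HB Require Import structures.
From mathcomp Require Import all_boot all_order all_algebra.
From mathcomp Require Export mpoly.

Set Implicit Arguments.
Unset Strict Implicit.
Unset Printing Implicit Defensive.

Import GRing.Theory.
Local Open Scope ring_scope.

Definition is_partition_of (n : nat) (s : seq nat) : bool :=
  [&& sorted geq s, 0%N \notin s & sumn s == n].

(* A partition of n has at most n parts, each at most n. *)
Definition partitions (n : nat) : seq (seq nat) :=
  [seq mu <- [seq map val (s : seq 'I_n.+1) | s : n.-bseq 'I_n.+1]
     | is_partition_of n mu].

Lemma partitions_uniq n : uniq (partitions n).
Proof.
rewrite filter_uniq // map_inj_uniq ?enum_uniq // => s t /= eq_st.
by apply/val_inj/(inj_map val_inj).
Qed.

Lemma mem_partitions n s : (s \in partitions n) = is_partition_of n s.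
Proof.
rewrite mem_filter andb_idr // => part_s; apply/imageP.
have /and3P[_ s0 /eqP sum_s] := part_s.
have size_le (r : seq nat) : 0%N \notin r -> (size r <= sumn r)%N.
  elim: r => //= x r IH; rewrite inE negb_or eq_sym -lt0n => /andP[x0 /IH le_r].
  by rewrite -add1n leq_add.
have part_le (r : seq nat) x : x \in r -> (x <= sumn r)%N.
  elim: r => //= y r IH; rewrite inE => /predU1P[-> | /IH le_x].
    exact: leq_addr.
  exact: leq_trans le_x (leq_addl _ _).
have size_t : (size (map (@inord n) s) <= n)%N.
  by rewrite size_map -[n in (_ <= n)%N]sum_s size_le.
have eq_s : map val (map (@inord n) s) = s.
  rewrite -map_comp -[RHS]map_id; apply/eq_in_map => x /part_le le_x /=.
  by rewrite inordK // ltnS -sum_s.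
by exists (Bseq size_t); rewrite /= ?eq_s.
Qed.

(* The ring of symmetric functions over the integers is the inverse limit, over
   the number m of variables, of the rings of symmetric polynomials. A symmetric
   function is thus given by its specializations to x_0, ..., x_(m-1) for all m,
   and an identity of symmetric functions is an identity for every m. *)
Definition symfun := forall m : nat, {mpoly int[m]}.

Definition elementary (s : seq nat) : symfun :=
  fun m => \prod_(k <- s) @mesym m int k.

Definition power_sum (s : seq nat) : symfun :=
  fun m => \prod_(k <- s) \sum_(i < m) 'X_i ^+ k.

Definition complete_homogeneous (s : seq nat) : symfun :=
  fun m => \prod_(k <- s) \sum_(u : 'X_{1..m < k.+1} | mdeg u == k) 'X_[u].

Definition is_expansion (n : nat) (b : seq nat -> symfun) (f : symfun)
    (a : seq nat -> int) : Prop :=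
  forall m, f m = \sum_(mu <- partitions n) a mu *: b mu m.

(* "c is the coefficient of b_lam in f": f is in the integral span of the
   b_mu, mu a partition of n, and every such expansion has c at lam. *)
Definition is_coefficient (n : nat) (b : seq nat -> symfun) (f : symfun)
    (lam : seq nat) (c : int) : Prop :=
  (exists a, is_expansion n b f a) /\
  (forall a, is_expansion n b f a -> a lam = c).

(* A digraph with vertex set T is its set of arrows D : {set T * T}; a spanning
   subdigraph of D is a subset of D. *)
Section Digraph.
Variable T : finType.
Implicit Types (D E F : {set T * T}) (C : {set T}) (s : seq T).

Definition components E : {set {set T}} :=
  let adj := [rel x y | ((x, y) \in E) || ((y, x) \in E)] in
  [set [set y | connect adj x y] | x : T].

Definition digraph_type E : seq nat :=
  sort geq [seq #|C| | C : {set T} in components E].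

(* The subdigraph of E induced on C is the directed path (resp. cycle) visiting
   in this order the vertices of s. *)
Definition traces_path E C s : bool :=
  [&& s != [::], uniq s, [set x in s] == C &
      E :&: setX C C == [set a in zip s (behead s)]].

Definition traces_cycle E C s : bool :=
  [&& s != [::], uniq s, [set x in s] == C &
      E :&: setX C C == [set a in zip s (rot 1 s)]].

Definition path_cover D E : bool :=
  (E \subset D) &&
  [forall C in components E, exists s : #|T|.-bseq T, traces_path E C s].

Definition cycle_cover D F : bool :=
  (F \subset D) &&
  [forall C in components F, exists s : #|T|.-bseq T, traces_cycle F C s].

(* traces_path makes s nonempty, so the default value x is never returned. *)
Definition first_vertex E C (x : T) : bool :=
  [exists s : #|T|.-bseq T, traces_path E C s && (head x s == x)].

Definition last_vertex E C (x : T) : bool :=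
  [exists s : #|T|.-bseq T, traces_path E C s && (last x s == x)].

Definition component E : finType := {C : {set T} | C \in components E}.

Definition quotient_digraph D E : {set component E * component E} :=
  [set vw | [exists x, exists y,
     [&& last_vertex E (val vw.1) x, first_vertex E (val vw.2) y
       & (x, y) \in D]]].

Definition adjacency_matrix D : 'M[int]_#|T| :=
  \matrix_(i, j) ((enum_val i, enum_val j) \in D)%:R.

Definition cycle_symfun D : symfun :=
  fun m => \sum_(F : {set T * T} | cycle_cover D F)
             power_sum (digraph_type F) m.

End Digraph.

Definition num_path_cycle_covers (T : finType) (D : {set T * T})
    (lam : seq nat) : nat :=
  #|[set EF : {E : {set T * T} & {set component E * component E}} |
      [&& path_cover D (tag EF), digraph_type (tag EF) == lam
        & cycle_cover (quotient_digraph D (tag EF)) (tagged EF)]]|.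

(* Main.v *)
Require Import Defs.
From mathcomp Require Import all_boot all_order all_algebra all_fingroup.

Set Implicit Arguments.
Unset Strict Implicit.
Unset Printing Implicit Defensive.

Import GRing.Theory.
Local Open Scope ring_scope.

(** In m variables, e_(t(E)) (resp. h_(t(E))), for a path cover E, is the sum of
    the monomials x^c over the colourings c of the vertices that increase
    strictly (resp. weakly) along E, and p_(t(F)), for a cycle cover F, is the
    sum over the colourings that are constant along F.

    Fix F, the graph of a permutation sigma, and a colouring c. The alternating
    sum of (-1)^|E| over the sets E of strict ascents of c is 1 if c has no
    strict ascent along F, i.e. is constant along F, and 0 otherwise; such an E
    contains no cycle, hence is a path cover. So
      p_(t(F)) = sum over path covers E contained in F of (-1)^|E| e_(t(E)).
    For weak ascents, an inclusion-exclusion over the cycles of F that E may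
    contain gives the same formula for h up to the signature of sigma.

    Summing over F, it remains to see that the cycle covers F of D containing E
    correspond to those of D/E, with the same number of cycles. The coefficients
    are unique since the e_k, and by the involution omega the h_k, are
    algebraically independent. *)

(** * Symmetric functions *)

(** The sum expands a product with one factor for each element. An element of [A] outside [B] gives
    the factor -1 + 1, and one of [B] outside [A] gives 0 + 0, so only [A = B] survives. *)
Lemma signed_sum_interval (R : comNzRingType) (T : finType) (A B : {set T}) :
  \sum_(S : {set T} | (B \subset S) && (S \subset A)) (-1) ^+ #|S| =
  (A == B)%:R * (-1) ^+ #|A| :> R.
Proof.
(* [F i] is the weight of putting [i] into [S], and [G i] that of leaving it out. *)
pose F i : R := if i \in A then -1 else 0.
pose G i : R := if i \in B then 0 else 1.
have sumE : \sum_(S : {set T} | (B \subset S) && (S \subset A)) (-1) ^+ #|S| =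
            \prod_i (F i + G i).
  rewrite bigA_distr big_mkcond /=; apply: eq_bigr => S _.
  case: ifPn => [/andP[/subsetP sBS /subsetP sSA]|].
    rewrite -sum1_card -prodrXr big_mkcond /=; apply: eq_bigr => i _.
    case: ifPn => [/sSA iA|iS]; first by rewrite /F iA expr1.
    by rewrite /G; case: ifPn => // /sBS; rewrite (negPf iS).
  rewrite negb_and => /orP[] /subsetPn[x x1 x2].
    by rewrite (bigD1 x) //= (negPf x2) /G x1 mul0r.
  by rewrite (bigD1 x) //= x1 /F (negPf x2) mul0r.
rewrite {}sumE; have [eqAB|neqAB] := eqVneq A B.
  rewrite mul1r -sum1_card -prodrXr [RHS]big_mkcond /=.
  by apply: eq_bigr => i _; rewrite /F /G -eqAB; case: ifP; rewrite ?addr0 ?add0r.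
rewrite mul0r; have [x neqx] : exists x, (x \in A) != (x \in B).
  apply/existsP; apply: contraNT neqAB; rewrite negb_exists => /forallP eqAB.
  by apply/eqP/setP => x; apply/eqP; rewrite -[_ == _]negbK.
rewrite (bigD1 x) //= /F /G; case: (x \in A) (x \in B) neqx => [] [] // _.
  by rewrite addNr mul0r.
by rewrite addr0 mul0r.
Qed.

Lemma signed_sum_subsets (R : comNzRingType) (T : finType) (A : {set T}) :
  \sum_(S : {set T} | S \subset A) (-1) ^+ #|S| = (A == set0)%:R :> R.
Proof.
have /= := signed_sum_interval R A set0.
under eq_bigl => S do rewrite sub0set.
move->; case: eqVneq => [->|_]; first by rewrite cards0 mulr1.
by rewrite mul0r.
Qed.

(** * Complete homogeneous polynomials and their relation with the elementary ones *)

Section CompleteHomogeneous.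
Variable m : nat.

Definition hsym (k : nat) : {mpoly int[m]} :=
  \sum_(u : 'X_{1..m < k.+1} | mdeg u == k) 'X_[u].

Lemma mcoeff_hsym k u : (hsym k)@_u = (mdeg u == k)%:R.
Proof.
rewrite raddf_sum /=; under eq_bigr do rewrite mcoeffX.
have [deg_u|neq_u] := eqVneq (mdeg u) k; last first.
  by rewrite big1 // => v /eqP deg_v; case: eqP => // eq_uv; rewrite -eq_uv deg_v eqxx in neq_u.
have lt_u : (mdeg u < k.+1)%N by rewrite deg_u.
rewrite (bigD1 (BMultinom lt_u)) /= ?deg_u // eqxx big1 ?addr0 // => v /andP[_].
by rewrite -val_eqE /= => /negPf ->.
Qed.

Lemma hsym0 : hsym 0 = 1.
Proof. by apply/mpolyP => u; rewrite mcoeff_hsym mcoeff1 mdeg_eq0. Qed.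

Lemma hsym_sym k : hsym k \is @mpoly.symmetric m int.
Proof.
apply/issymP => s; apply/mpolyP => u.
by rewrite mcoeff_sym !mcoeff_hsym mdeg_mperm.
Qed.

Lemma prodX_s2m (s : seq 'I_m) : \prod_(i <- s) 'X_i = 'X_[s2m s] :> {mpoly int[m]}.
Proof.
rewrite mprodXE; congr 'X_[_]; apply/mnmP => i.
rewrite mnmE mnm_sumE -sum1_count [RHS]big_mkcond /=; apply: eq_bigr => j _.
by rewrite mnm1E; case: eqP.
Qed.

(** Each monomial of degree [k] is spelled by exactly one weakly increasing word. This is the form
    that colourings of a path need. *)
Lemma hsym_tupleE k :
  hsym k = \sum_(t : k.-tuple 'I_m | sorted leq (map val t)) \prod_(i <- t) 'X_i.
Proof.
apply/mpolyP => u; rewrite mcoeff_hsym raddf_sum /=.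
under eq_bigr do rewrite prodX_s2m mcoeffX.
rewrite basis_cover; case: mapP => [[t]|no_t].
  rewrite mem_enum inE /= => srt_t ->.
  rewrite (bigD1 t) //= eqxx big1 ?addr0 // => v /andP[srt_v neq_v].
  case: eqP => // /inj_s2m eq_vt; rewrite eq_vt ?inE ?eqxx // in neq_v.
rewrite big1 // => t srt_t; case: eqP => // eq_u; case: no_t.
by exists t; rewrite // mem_enum inE.
Qed.

Lemma mcoeff_mesym1_mul (S : {set 'I_m}) (p : {mpoly int[m]}) u :
  ('X_[mesym1 S] * p)@_u =
  if S \subset [set i | u i != 0%N] then p@_(u - mesym1 S)%MM else 0.
Proof.
rewrite mulrC; case: ifPn => [/subsetP sS|].
  have leSu : (mesym1 S <= u)%MM.
    apply/mnm_lepP => i; rewrite mnmE; case: (boolP (i \in S)) => //= /sS.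
    by rewrite inE lt0n.
  by rewrite -[in LHS](submK leSu) addmC mcoeffMX.
case/subsetPn => i iS; rewrite inE negbK => /eqP ui0.
apply/eqP; rewrite mcoeff_eq0 (perm_mem (msuppMX _ _)).
apply/mapP => -[v _ eq_u]; move: ui0.
by rewrite eq_u mnmDE mnmE iS.
Qed.

(** For [u] of degree [k], the coefficient of X^u in e_i h_(k-i) counts the [i]-subsets of the
    support of [u]. The alternating sum thus runs over all subsets of the support, which is nonempty
    since [k > 0], and cancels. *)
Lemma elementary_complete_relation k : (0 < k)%N ->
  \sum_(i < k.+1) (-1) ^+ i * (mesym m int i * hsym (k - i)%N) = 0.
Proof.
move=> k_gt0; apply/mpolyP => u; rewrite mcoeff0 raddf_sum /=.
pose supp := [set i | u i != 0%N].
have termE (i : 'I_k.+1) : ((-1) ^+ i * (mesym m int i * hsym (k - i)%N))@_u =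
    \sum_(S : {set 'I_m} | (#|S| == i) && (S \subset supp))
      (mdeg u == k)%:R * (-1) ^+ #|S|.
  rewrite -signr_odd mulr_sign; set p := mesym _ _ _ * _.
  have -> : (if odd i then - p else p)@_u = (-1) ^+ i * p@_u.
    by rewrite -signr_odd mulr_sign; case: odd; rewrite ?mcoeffN.
  rewrite /p mesymE mulr_suml raddf_sum /= mulr_sumr [RHS]big_mkcondr /=.
  apply: eq_bigr => S /eqP cardS; rewrite mcoeff_mesym1_mul -/supp.
  case: ifPn => [sS|_]; last by rewrite mulr0.
  rewrite mcoeff_hsym cardS mulrC; congr (_%:R * _).
  have leSu : (mesym1 S <= u)%MM.
    apply/mnm_lepP => j; rewrite mnmE; case: (boolP (j \in S)) => //= /(subsetP sS).
    by rewrite inE lt0n.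
  have <- : (mdeg (u - mesym1 S) + i)%N = mdeg u.
    by rewrite -[in RHS](submK leSu) mdegD mdeg_mesym1 cardS.
  by rewrite -[X in (_ + _ == X)%N](subnK (leq_ord i)) eqn_add2r.
rewrite (eq_bigr _ (fun i _ => termE i)) {termE}.
have [deg_u|_] := eqVneq (mdeg u) k; last first.
  by rewrite big1 // => i _; rewrite big1 // => S _; rewrite mul0r.
have suppN0 : supp != set0.
  apply: contraTneq k_gt0 => supp0; rewrite -deg_u lt0n negbK mdegE sum_nat_eq0.
  apply/forallP => i; have := in_set0 i; rewrite -supp0 inE => /negbFE -> //.
have := signed_sum_subsets int supp; rewrite (negPf suppN0) => sum0; rewrite -[RHS]sum0 {sum0}.
under eq_bigr do under eq_bigr do rewrite mul1r.
have card_lt (S : {set 'I_m}) : S \subset supp -> (#|S| < k.+1)%N.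
  move=> sS; rewrite ltnS (leq_trans (subset_leq_card sS)) // -deg_u mdegE.
  rewrite -sum1_card big_mkcond /=; apply: leq_sum => i _.
  by rewrite inE -lt0n; case: (u i).
(* Subsets of the support have at most [k] elements, so [inord] does not alter their cardinality. *)
rewrite (partition_big (fun S : {set 'I_m} => inord #|S| : 'I_k.+1) predT) //=.
apply: eq_bigr => i _; apply: eq_bigl => S; rewrite andbC.
case: (boolP (S \subset supp)) => //= /card_lt lt_S.
by rewrite -val_eqE /= inordK.
Qed.

End CompleteHomogeneous.

(** * Algebraic independence and uniqueness of coefficients *)

Section Independence.
Variable n : nat.
Implicit Types (G : n.-tuple {mpoly int[n]}).

Definition algebraically_independent G :=
  forall Q : {mpoly int[n]}, Q \mPo G = 0 -> Q = 0.

Lemma mesym_independent :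
  algebraically_independent [tuple mesym n int i.+1 | i < n].
Proof. exact: msym_fundamental_un0. Qed.

(* The substitution y_k |-> t_k, where h_k = t_k(e_1, ..., e_n), is the
   involution omega: the relation between e and h is symmetric up to sign. *)
Lemma hsym_independent :
  algebraically_independent [tuple hsym n i.+1 | i < n].
Proof.
pose S := [tuple mesym n int i.+1 | i < n].
have sol k : {t | t \mPo S = hsym n k}.
  by have [t []] := sym_fundamental (hsym_sym n k); exists t.
pose t k := sval (sol k).
have tE k : t k \mPo S = hsym n k by rewrite /t; case: (sol k).
(* [y k] is the variable standing for e_k, with [y 0 = 1]; variables are indexed from 0, so for
   [0 < k <= n] the sum is the single variable of index [k - 1]. *)
pose y k : {mpoly int[n]} := if k is k'.+1 then \sum_(i < n | i == k' :> nat) 'X_i else 1.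
have yS (i : 'I_n) : y i.+1 = 'X_i.
  by rewrite /y (big_pred1 i).
have yE k : (k <= n)%N -> y k \mPo S = mesym n int k.
  case: k => [_|k lt_k]; first by rewrite comp_mpoly1 mesym0E.
  by rewrite (yS (Ordinal lt_k)) comp_mpolyXU -tnth_nth tnth_mktuple.
have signM (G : n.-tuple {mpoly int[n]}) k (p q : {mpoly int[n]}) :
    ((-1) ^+ k * (p * q)) \mPo G = (-1) ^+ k * ((p \mPo G) * (q \mPo G)).
  by rewrite !rmorphM rmorphXn rmorphN rmorph1.
have t0 : t 0%N = 1.
  by apply: msym_fundamental_un; rewrite tE hsym0 comp_mpoly1.
have relyt k : (0 < k <= n)%N -> \sum_(i < k.+1) (-1) ^+ i * (y i * t (k - i)%N) = 0.
  move=> /andP[k_gt0 le_kn]; apply: msym_fundamental_un.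
  rewrite comp_mpoly0 raddf_sum /= -[RHS](elementary_complete_relation n k_gt0).
  apply: eq_bigr => i _; rewrite signM tE yE //.
  exact: leq_trans (leq_ord i) le_kn.
have relty k : (0 < k <= n)%N -> \sum_(i < k.+1) (-1) ^+ i * (t i * y (k - i)%N) = 0.
  (* Reversing the order of summation turns one relation into (-1)^k times the other. *)
  move=> hk; apply/eqP; rewrite -(mulrI_eq0 _ (@lreg_sign _ k)) mulr_sumr.
  rewrite -[X in _ == X](relyt k hk) (reindex_inj rev_ord_inj) /=; apply/eqP.
  apply: eq_bigr => i _; rewrite subSS subKn ?leq_ord //.
  rewrite mulrA -exprD (mulrC (t _)); congr (_ * _).
  by rewrite -[LHS]signr_odd oddD oddB ?leq_ord // addbA addbb signr_odd.
pose H := [tuple t i.+1 | i < n].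
have omega_y k : (k <= n)%N -> y k \mPo H = t k.
  case: k => [_|k lt_k]; first by rewrite comp_mpoly1 t0.
  by rewrite (yS (Ordinal lt_k)) comp_mpolyXU -tnth_nth tnth_mktuple.
have omega_t k : (k <= n)%N -> t k \mPo H = y k.
  elim/ltn_ind: k => k IH le_kn.
  have [k0|k_gt0] := posnP k; first by rewrite k0 t0 comp_mpoly1.
  have hk : (0 < k <= n)%N by rewrite k_gt0.
  (* Under the substitution the first relation becomes the second in every term with positive index,
     by induction; comparing the remaining terms gives the claim for [k]. *)
  have := congr1 (comp_mpoly H) (relyt k hk).
  rewrite comp_mpoly0 -[RHS](relty k hk) raddf_sum /= !big_ord_recl /= !subn0.
  rewrite t0 !mul1r.
  set s1 := \sum_(i < k) _; set s2 := \sum_(i < k) _.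
  suff -> : s1 = s2 by move/addIr.
  apply: eq_bigr => i _; rewrite -[bump 0 i]/i.+1.
  rewrite -[X in _ * (X * _)]/(y i.+1) signM omega_y ?(leq_trans (ltn_ord i)) //.
  by rewrite IH ?(leq_trans (leq_subr _ _)) // ltn_subrL.
move=> Q Q0.
have compA (P : {mpoly int[n]}) (G1 G2 : n.-tuple {mpoly int[n]}) :
    (P \mPo G1) \mPo G2 = P \mPo [tuple tnth G1 i \mPo G2 | i < n].
  rewrite [P \mPo G1]comp_mpolyE [RHS]comp_mpolyE raddf_sum /=; apply: eq_bigr => u _.
  rewrite comp_mpolyZ rmorph_prod /=; congr (_ *: _).
  by apply: eq_bigr => i _; rewrite rmorphXn tnth_mktuple.
(* Since h_k = t_k(e), the relation says that Q(t) vanishes at the e_k, so Q(t) = 0. Substituting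
   [t] once more returns Q, the substitution being an involution. *)
have QH0 : Q \mPo H = 0.
  apply: msym_fundamental_un0; rewrite compA -[RHS]Q0; congr (_ \mPo _).
  by apply: eq_from_tnth => i; rewrite !tnth_mktuple tE.
have := congr1 (comp_mpoly H) QH0; rewrite comp_mpoly0 compA => <-.
rewrite -[LHS]comp_mpoly_id; congr (_ \mPo _).
by apply: eq_from_tnth => i; rewrite !tnth_mktuple omega_t // yS.
Qed.

Lemma partition_part s k : is_partition_of n s -> k \in s -> (0 < k <= n)%N.
Proof.
case/and3P => _ s0 /eqP <- ks; rewrite lt0n.
rewrite (contraNneq _ s0) => [|<-] //=.
by rewrite sumnE (big_rem k) //= leq_addr.
Qed.

Lemma prod_count (R : comNzRingType) (f : nat -> R) s :
  {in s, forall k, (0 < k <= n)%N} ->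
  \prod_(k <- s) f k = \prod_(i < n) f i.+1 ^+ count_mem i.+1 s.
Proof.
elim: s => [_|k s IH bnd_s]; first by rewrite big_nil big1.
rewrite big_cons IH => [|j js]; last by apply: bnd_s; rewrite inE js orbT.
have := bnd_s k (mem_head _ _); case: k {bnd_s} => // k /andP[_ lt_k].
rewrite (bigD1 (Ordinal lt_k)) // [RHS](bigD1 (Ordinal lt_k)) //= eqxx exprD mulrA.
rewrite expr1; congr (_ * _); apply: eq_bigr => i; rewrite -val_eqE /= eqSS eq_sym.
by move/negPf ->.
Qed.

Lemma partition_monomial_inj :
  {in is_partition_of n &, injective (fun s => [multinom count_mem i.+1 s | i < n])}.
Proof.
move=> s1 s2 part1 part2 /mnmP eq12.
have [/and3P[srt1 _ _] /and3P[srt2 _ _]] := (part1, part2).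
apply: (sorted_eq _ _ srt1 srt2); first by move=> x y z /= ? yz; exact: leq_trans yz _.
  by move=> x y /= /andP[? ?]; apply/eqP; rewrite eqn_leq; apply/andP.
apply/allP => k; rewrite mem_cat => k12 /=; apply/eqP.
have : (0 < k <= n)%N by case/orP: k12; apply: partition_part.
case: k {k12} => // k /andP[_ lt_k].
by have := eq12 (Ordinal lt_k); rewrite !mnmE.
Qed.

(** Distinct partitions of [n] have distinct multiplicity vectors, so the products are values at [G]
    of distinct monomials, and a linear relation between them is a polynomial relation between the
    entries of [G]. *)
Lemma partition_products_free G (f : nat -> {mpoly int[n]}) (a : seq nat -> int) :
    algebraically_independent G -> (forall i : 'I_n, tnth G i = f i.+1) ->
    \sum_(mu <- partitions n) a mu *: \prod_(k <- mu) f k = 0 ->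
  forall lam, is_partition_of n lam -> a lam = 0.
Proof.
move=> indepG Gf sum0 lam part_lam.
pose mon (s : seq nat) := [multinom count_mem i.+1 s | i < n].
have Q0 : \sum_(mu <- partitions n) a mu *: 'X_[mon mu] = 0 :> {mpoly int[n]}.
  apply: indepG; rewrite -[RHS]sum0 raddf_sum /=.
  rewrite !big_seq; apply: eq_bigr => mu; rewrite mem_partitions => part_mu.
  rewrite comp_mpolyZ comp_mpolyX prod_count => [|k]; last exact: partition_part.
  by congr (_ *: _); apply: eq_bigr => i _; rewrite Gf mnmE.
have := congr1 (mcoeff (mon lam)) Q0.
rewrite mcoeff0 raddf_sum /= (bigD1_seq lam) ?partitions_uniq ?mem_partitions //=.
rewrite mcoeffZ mcoeffX eqxx mulr1 big_seq_cond big1 ?addr0 // => mu.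
rewrite mem_partitions => /andP[part_mu neq_mu].
rewrite mcoeffZ mcoeffX; case: eqP => [eq_mon|_]; last by rewrite mulr0.
by rewrite (partition_monomial_inj part_mu part_lam eq_mon) eqxx in neq_mu.
Qed.

End Independence.

(** Linear independence makes expansions unique, so exhibiting one of them determines the
    coefficient. *)
Lemma is_coefficientP n (b : seq nat -> symfun) (f : symfun) (a : seq nat -> int) lam :
    (forall c, (forall m, \sum_(mu <- partitions n) c mu *: b mu m = 0) ->
       forall mu, is_partition_of n mu -> c mu = 0) ->
    is_partition_of n lam -> is_expansion n b f a ->
  is_coefficient n b f lam (a lam).
Proof.
move=> free_b part_lam exp_a; split=> [|a' exp_a']; first by exists a.
apply/eqP; rewrite -subr_eq0; apply/eqP.
apply: (free_b (fun mu => a' mu - a mu)) part_lam => m.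
under eq_bigr do rewrite scalerBl.
by rewrite sumrB -exp_a -exp_a' subrr.
Qed.

(** The specialization to [n] variables is enough, since e_1, ..., e_n are already independent
    there. *)
Lemma elementary_free n (c : seq nat -> int) :
    (forall m, \sum_(mu <- partitions n)
       c mu *: ((-1) ^+ (n - size mu)%N *: elementary mu m) = 0) ->
  forall mu, is_partition_of n mu -> c mu = 0.
Proof.
move=> sum0 mu part_mu; have := sum0 n.
under eq_bigr do rewrite scalerA.
move/(partition_products_free (@mesym_independent n)) => /(_ _ mu part_mu).
have tnthE (i : 'I_n) : tnth [tuple mesym n int i.+1 | i < n] i = mesym n int i.+1.
  by rewrite tnth_mktuple.
by move/(_ tnthE)/eqP; rewrite mulf_eq0 signr_eq0 orbF => /eqP.
Qed.

Lemma complete_homogeneous_free n (c : seq nat -> int) :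
    (forall m, \sum_(mu <- partitions n) c mu *: complete_homogeneous mu m = 0) ->
  forall mu, is_partition_of n mu -> c mu = 0.
Proof.
move=> sum0; apply: (partition_products_free (@hsym_independent n)) (sum0 n) => i.
by rewrite tnth_mktuple.
Qed.

(** * Colourings and components *)

Section Colourings.
Variables (I : finType) (R : comNzRingType) (X : I -> R).

(** Choosing a word for each part amounts to choosing their concatenation, which [reshape] cuts
    back. *)
Lemma prod_sum_tuples (Q : pred (seq I)) (sh : seq nat) :
  \prod_(k <- sh) (\sum_(t : k.-tuple I | Q t) \prod_(i <- t) X i) =
  \sum_(t : (sumn sh).-tuple I | all Q (reshape sh t)) \prod_(i <- t) X i.
Proof.
elim: sh => [|k sh IH].
  rewrite big_nil (big_pred1 [tuple]) ?big_nil // => t.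
  by rewrite [t]tuple0 /= eqxx.
rewrite big_cons IH big_distrlr pair_big /=.
pose f (p : k.-tuple I * (sumn sh).-tuple I) : (k + sumn sh).-tuple I :=
  cat_tuple p.1 p.2.
have f_inj : injective f.
  move=> [t1 u1] [t2 u2] /(congr1 val) /= /eqP.
  by rewrite eqseq_cat ?size_tuple // => /andP[/eqP/val_inj-> /eqP/val_inj->].
have f_bij : bijective f.
  by apply: inj_card_bij => //; rewrite card_prod !card_tuple expnD.
rewrite [RHS](reindex f) /=; last exact: onW_bij.
apply: eq_big => [[t u]|[t u] _] /=; last by rewrite big_cat.
by rewrite take_size_cat ?drop_size_cat ?size_tuple.
Qed.

Lemma sum_colourings (T : finType) (e : seq T) (k : nat) (G : seq I -> R) :
    perm_eq e (enum T) -> size e = k ->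
  \sum_(c : {ffun T -> I}) G (map c e) = \sum_(t : k.-tuple I) G t.
Proof.
move=> perm_e size_e.
have size_ce (c : {ffun T -> I}) : size (map c e) == k by rewrite size_map size_e.
pose f (c : {ffun T -> I}) : k.-tuple I := Tuple (size_ce c).
have f_inj : injective f.
  move=> c1 c2 /(congr1 val) /= /eq_in_map eq12; apply/ffunP => x; apply: eq12.
  by rewrite (perm_mem perm_e) mem_enum.
have f_bij : bijective f.
  apply: inj_card_bij => //.
  by rewrite card_tuple card_ffun -size_e (perm_size perm_e) -cardT.
by rewrite [RHS](reindex f) //=; apply: onW_bij.
Qed.

(** The lists in [ss] enumerate the vertices component by component, so a colouring is the same as
    one word for each list. *)
Lemma prod_sum_colourings (T : finType) (ss : seq (seq T)) (Q : pred (seq I)) :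
    perm_eq (flatten ss) (enum T) ->
  \prod_(k <- map size ss) (\sum_(t : k.-tuple I | Q t) \prod_(i <- t) X i) =
  \sum_(c : {ffun T -> I} | all (fun s => Q (map c s)) ss) \prod_x X (c x).
Proof.
move=> perm_ss; rewrite prod_sum_tuples big_mkcond /= [RHS]big_mkcond /=.
pose G t := if all Q (reshape (map size ss) t) then \prod_(i <- t) X i else 0.
rewrite -(@sum_colourings T _ _ G perm_ss) ?size_flatten //.
apply: eq_bigr => c _; rewrite /G -map_reshape flattenK all_map.
congr (if _ then _ else _); rewrite big_map (perm_big _ perm_ss) /=.
by rewrite big_enum.
Qed.

End Colourings.

Lemma sorted_map_arcs (T I : eqType) (c : T -> I) (r : rel I) (s : seq T) :
  sorted r (map c s) = all (fun a => r (c a.1) (c a.2)) (zip s (behead s)).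
Proof. by case: s => //= x s; elim: s x => //= y s IH x; rewrite IH. Qed.

Lemma mem_zipP (T : eqType) x0 (s t : seq T) x y :
  reflect (exists i, [/\ (i < size s)%N, (i < size t)%N, x = nth x0 s i & y = nth x0 t i])
          ((x, y) \in zip s t).
Proof.
elim: s t x y => [|a s IH] [|b t] x y /=; try by constructor=> -[i []].
rewrite inE; apply: (iffP idP) => [/predU1P[[-> ->]|/IH[i [? ? ? ?]]]|[[|i] /= [? ? -> ->]]].
- by exists 0%N.
- by exists i.+1.
- by rewrite eqxx.
- by apply/orP; right; apply/IH; exists i.
Qed.

(** * Components of a digraph and colourings compatible with its arcs *)

Section Components.
Variable T : finType.
Implicit Types (D E F : {set T * T}) (C : {set T}) (s : seq T).

Definition adjacent E : rel T := [rel x y | ((x, y) \in E) || ((y, x) \in E)].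

Definition component_at E x : {set T} := [set y | connect (adjacent E) x y].

Lemma adjacent_connect_sym E : connect_sym (adjacent E).
Proof. by apply: sym_connect_sym => x y; rewrite /adjacent /= orbC. Qed.

Lemma component_at_components E x : component_at E x \in components E.
Proof. exact: imset_f. Qed.

Lemma mem_component_at E x : x \in component_at E x.
Proof. by rewrite inE connect0. Qed.

Lemma component_at_eq E x y : y \in component_at E x -> component_at E y = component_at E x.
Proof.
rewrite inE => xy; apply/setP => z; rewrite !inE.
by rewrite (same_connect (@adjacent_connect_sym E) xy).
Qed.

Lemma componentsE E C x : C \in components E -> x \in C -> C = component_at E x.
Proof. by case/imsetP => y _ -> /component_at_eq. Qed.

Lemma component_at_arc E x y : (x, y) \in E -> component_at E x = component_at E y.
Proof.
by move=> xy; apply/esym/component_at_eq; rewrite inE connect1 // /adjacent /= xy.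
Qed.

Lemma component_arc E C x y : C \in components E -> (x, y) \in E -> (x \in C) = (y \in C).
Proof.
move=> compC xy; apply/idP/idP => inC; rewrite (componentsE compC inC).
  by rewrite (component_at_arc xy) mem_component_at.
by rewrite -(component_at_arc xy) mem_component_at.
Qed.

Lemma component_sub_class E x (C : {pred T}) :
    x \in C -> (forall y z, (y, z) \in E -> (y \in C) = (z \in C)) ->
  component_at E x \subset C.
Proof.
move=> xC closedC; apply/subsetP => y; rewrite inE => xy.
rewrite -(closed_connect _ xy) // => u v /= /orP[/closedC //|/closedC ->//].
Qed.

Lemma components_partition E : partition (components E) [set: T].
Proof.
apply/and3P; split.
- apply/eqP/setP => x; rewrite inE; apply/bigcupP.
  by exists (component_at E x); rewrite ?component_at_components ?mem_component_at.
- apply/trivIsetP => A B compA compB neqAB; rewrite -setI_eq0.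
  apply: contraNT neqAB => /set0Pn[x]; rewrite inE => /andP[xA xB].
  by rewrite (componentsE compA xA) (componentsE compB xB).
- apply/negP => /imsetP[x _ /setP/(_ x)].
  by rewrite inE -/(adjacent E) inE connect0.
Qed.

Lemma digraph_type_partition E : is_partition_of #|T| (digraph_type E).
Proof.
apply/and3P; split.
- by apply: sort_sorted => x y /=; rewrite leq_total.
- rewrite mem_sort; apply/mapP => -[C]; rewrite mem_enum => compC /esym/eqP.
  rewrite cards_eq0 => /eqP C0; rewrite C0 in compC.
  by case/and3P: (components_partition E) => _ _; rewrite compC.
- rewrite sumnE (perm_big _ (permEl (perm_sort _ _))) big_map big_enum /=.
  by rewrite -cardsT (card_partition (components_partition E)).
Qed.

Lemma size_digraph_type E : size (digraph_type E) = #|components E|.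
Proof. by rewrite size_sort size_map -cardE. Qed.

(** One list is picked in each component. [Q] is left abstract to serve both paths and cycles. No
    arc is lost, because its two ends share a component. *)
Lemma component_lists E (Q : {set T} -> seq T -> bool) :
    (forall C, C \in components E ->
       exists s : #|T|.-bseq T, [&& uniq s, [set x in s] == C & Q C s]) ->
  exists ss : seq (seq T),
    [/\ perm_eq (flatten ss) (enum T), perm_eq (map size ss) (digraph_type E),
        forall s, s \in ss -> Q [set x in s] s &
        forall a, (a \in E) =
          has (fun s => a \in E :&: setX [set x in s] [set x in s]) ss].
Proof.
move=> exQ.
pose tr C : seq T := oapp (@bseqval _ T) [::]
  [pick s : #|T|.-bseq T | [&& uniq s, [set x in s] == C & Q C s]].
have trP C : C \in components E -> [&& uniq (tr C), [set x in tr C] == C & Q C (tr C)].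
  move=> /exQ[s hs]; rewrite /tr; case: pickP => [//|/(_ s)]; by rewrite hs.
have size_tr C : C \in components E -> size (tr C) = #|C|.
  by case/trP/and3P => /card_uniqP <- /eqP eqC _; rewrite -[in RHS]eqC cardsE.
have size_ss : map size [seq tr C | C <- enum (components E)] =
               [seq #|C| | C : {set T} in components E].
  rewrite -map_comp; apply/eq_in_map => C; rewrite mem_enum; exact: size_tr.
have mem_tr C x : C \in components E -> (x \in tr C) = (x \in C).
  by case/trP/and3P => _ /eqP eqC _; rewrite -[in RHS]eqC inE.
have in_flatten x : x \in flatten [seq tr C | C <- enum (components E)].
  apply/flatten_mapP; exists (component_at E x).
    by rewrite mem_enum component_at_components.
  by rewrite mem_tr ?component_at_components ?mem_component_at.
exists [seq tr C | C <- enum (components E)]; split.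
- apply: uniq_perm; rewrite ?enum_uniq //; last first.
    by move=> x; rewrite in_flatten mem_enum.
  (* Every vertex occurs in the concatenation, whose length is the sum of the component sizes, so
     none can occur twice. *)
  apply: (@leq_size_uniq _ (enum T)); rewrite ?enum_uniq //.
  rewrite size_flatten /shape size_ss sumnE big_map big_enum /=.
  by rewrite -(card_partition (components_partition E)) cardsT cardE.
- by rewrite size_ss perm_sym (permEl (perm_sort _ _)).
- move=> s /mapP[C]; rewrite mem_enum => compC ->.
  by case/and3P: (trP C compC) => _ /eqP ->.
- move=> [x y]; apply/idP/hasP => [xy|[s _]]; last by case/setIP.
  have compx := component_at_components E x.
  exists (tr (component_at E x)); first by rewrite map_f ?mem_enum.
  rewrite !inE /= xy !mem_tr // mem_component_at /=.
  by rewrite (component_at_arc xy) mem_component_at.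
Qed.

Lemma path_cover_lists D E : path_cover D E ->
  exists ss : seq (seq T),
    [/\ perm_eq (flatten ss) (enum T), perm_eq (map size ss) (digraph_type E) &
        forall a, (a \in E) = has (fun s => a \in zip s (behead s)) ss].
Proof.
case/andP => _ /forall_inP coverE.
have [C compC|ss [perm_ss size_ss trace_ss memE]] :=
  @component_lists E (fun C s => E :&: setX C C == [set a in zip s (behead s)]).
  case/existsP: (coverE C compC) => s /and4P[_ ? ? ?]; exists s; exact/and3P.
exists ss; split=> // a; rewrite memE; apply: eq_in_has => s /trace_ss/eqP ->.
by rewrite inE.
Qed.

Lemma cycle_cover_lists D F : cycle_cover D F ->
  exists ss : seq (seq T),
    [/\ perm_eq (flatten ss) (enum T), perm_eq (map size ss) (digraph_type F) &
        forall a, (a \in F) = has (fun s => a \in zip s (rot 1 s)) ss].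
Proof.
case/andP => _ /forall_inP coverF.
have [C compC|ss [perm_ss size_ss trace_ss memF]] :=
  @component_lists F (fun C s => F :&: setX C C == [set a in zip s (rot 1 s)]).
  case/existsP: (coverF C compC) => s /and4P[_ ? ? ?]; exists s; exact/and3P.
exists ss; split=> // a; rewrite memF; apply: eq_in_has => s /trace_ss/eqP ->.
by rewrite inE.
Qed.

Lemma sorted_lists_arcs (I : eqType) (c : T -> I) (r : rel I) E (ss : seq (seq T)) :
    (forall a, (a \in E) = has (fun s => a \in zip s (behead s)) ss) ->
  all (fun s => sorted r (map c s)) ss = [forall a in E, r (c a.1) (c a.2)].
Proof.
move=> memE; under eq_all do rewrite sorted_map_arcs.
apply/allP/forall_inP => [incr a|incr s s_ss].
  by rewrite memE => /hasP[s /incr/allP incr_s /incr_s].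
by apply/allP => a a_s; apply: incr; rewrite memE; apply/hasP; exists s.
Qed.

(** e_k is the sum over strictly increasing words of length [k]; a word for each path is a
    colouring, and strict increase along the paths is a condition on the arcs. *)
Lemma elementary_colourings D E m : path_cover D E ->
  elementary (digraph_type E) m =
  \sum_(c : {ffun T -> 'I_m} | [forall a in E, (c a.1 < c a.2)%N]) \prod_x 'X_(c x).
Proof.
move=> /path_cover_lists[ss [perm_ss size_ss memE]].
rewrite /elementary -(perm_big _ size_ss) /=.
under eq_bigr do rewrite mesym_tupleE.
rewrite (prod_sum_colourings (fun i => 'X_i) (@tmono m) perm_ss); apply: eq_bigl => c.
rewrite -(sorted_lists_arcs (fun x => val (c x)) ltn memE).
by apply: eq_all => s; rewrite /tmono -map_comp.
Qed.

Lemma complete_homogeneous_colourings D E m : path_cover D E ->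
  complete_homogeneous (digraph_type E) m =
  \sum_(c : {ffun T -> 'I_m} | [forall a in E, (c a.1 <= c a.2)%N]) \prod_x 'X_(c x).
Proof.
move=> /path_cover_lists[ss [perm_ss size_ss memE]].
rewrite /complete_homogeneous -(perm_big _ size_ss) /=.
under eq_bigr do rewrite -/(hsym m _) hsym_tupleE.
rewrite (prod_sum_colourings (fun i => 'X_i) (fun t => sorted leq (map val t)) perm_ss).
apply: eq_bigl => c.
rewrite -(sorted_lists_arcs (fun x => val (c x)) leq memE).
by apply: eq_all => s; rewrite -map_comp.
Qed.

(** A constant word is determined by its first letter, which exists because [k] is positive; at
    [k = 0] the two sides would be [m] and 1. *)
Lemma power_sum_tupleE m k : (0 < k)%N ->
  \sum_(i < m) 'X_i ^+ k =
  \sum_(t : k.-tuple 'I_m | constant t) \prod_(i <- t) 'X_i :> {mpoly int[m]}.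
Proof.
case: k => // k _; pose f i : k.+1.-tuple 'I_m := nseq_tuple k.+1 i.
rewrite [RHS](reindex_onto f (fun t => thead t)) => [|t] /=.
  apply: eq_big => [i|i _]; last first.
    by rewrite -[RHS]/(\prod_(j <- nseq k.+1 i) 'X_j) big_nseq iter_mulr_1.
  by rewrite /thead (tnth_nth i) /= eqxx andbT all_pred1_nseq.
case/tupleP: t => x t /=; rewrite theadE => /all_pred1P const_t; apply: val_inj.
by rewrite /= const_t size_tuple.
Qed.

Lemma power_sum_colourings D F m : cycle_cover D F ->
  power_sum (digraph_type F) m =
  \sum_(c : {ffun T -> 'I_m} | [forall a in F, c a.1 == c a.2]) \prod_x 'X_(c x).
Proof.
move=> /cycle_cover_lists[ss [perm_ss size_ss memF]].
rewrite /power_sum -(perm_big _ size_ss) /=.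
have size_gt0 k : k \in map size ss -> (0 < k)%N.
  rewrite (perm_mem size_ss) lt0n => kF.
  by case/and3P: (digraph_type_partition F) => _ + _; apply: contraNneq => <-.
rewrite big_seq; under eq_bigr => k k_ss do rewrite power_sum_tupleE ?size_gt0 //.
rewrite -big_seq (prod_sum_colourings (fun i => 'X_i) constant perm_ss).
apply: eq_bigl => c.
apply/allP/forall_inP => [const [x y]|const s s_ss].
  rewrite memF => /hasP[s s_ss /(mem_zipP x)[i [lt_s]]].
  rewrite size_rot => _ -> /= y_nth.
  have ys : y \in s by rewrite -(mem_rot 1) y_nth mem_nth ?size_rot.
  have := const s s_ss; case: s {s_ss y_nth} lt_s ys => //= z s lt_s ys /allP col.
  have colz u : u \in z :: s -> c u = c z.
    by rewrite inE => /predU1P[-> //|us]; apply/eqP/col/map_f.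
  by rewrite (colz y) // colz ?mem_nth.
(* The arcs between consecutive entries of [s] are among its cyclic arcs, so neighbours share a
   colour and the word is constant. *)
have : sorted eq_op (map c s).
  rewrite sorted_map_arcs; apply/allP => -[x y] xy; apply: const; rewrite memF.
  apply/hasP; exists s => //; move: xy => /(mem_zipP x)[i [lt_s lt_i eqx eqy]].
  apply/(mem_zipP x); exists i; rewrite size_rot; split=> //; rewrite eqy.
  by case: s lt_i {s_ss lt_s eqx eqy} => //= z s lt_i; rewrite rot1_cons nth_rcons lt_i.
case: s {s_ss} => //= z s; elim: s z => //= u s IH z /andP[/eqP <-] /IH.
by rewrite eqxx.
Qed.

End Components.

(** * Cycle covers as permutations *)

Section PermutationArcs.
Variable T : finType.
Implicit Types (D E F : {set T * T}) (A B C : {set T}) (s t : seq T) (sg : {perm T}).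

Lemma zip_uniq_fst s t x y y' :
  uniq s -> (x, y) \in zip s t -> (x, y') \in zip s t -> y = y'.
Proof.
move=> uniq_s /(mem_zipP x)[i [lt_i _ xi ->]] /(mem_zipP x)[j [lt_j _ xj ->]].
by congr nth; apply/eqP; rewrite -(nth_uniq x lt_i lt_j uniq_s) -xi -xj.
Qed.

Lemma zip_uniq_snd s t x x' y :
  uniq t -> (x, y) \in zip s t -> (x', y) \in zip s t -> x = x'.
Proof.
move=> uniq_t /(mem_zipP y)[i [_ lt_i -> yi]] /(mem_zipP y)[j [_ lt_j -> yj]].
by congr nth; apply/eqP; rewrite -(nth_uniq y lt_i lt_j uniq_t) -yi -yj.
Qed.

(** For [A = setT] this is a cycle cover; for [A] containing no whole orbit it is a path cover. *)
Definition arcs sg A : {set T * T} := [set (x, sg x) | x in A].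

Lemma mem_arcs sg A x y : ((x, y) \in arcs sg A) = (x \in A) && (y == sg x).
Proof.
apply/imsetP/andP => [[z zA [-> ->]]|[xA /eqP ->]]; first by rewrite zA eqxx.
by exists x.
Qed.

Lemma card_arcs sg A : #|arcs sg A| = #|A|.
Proof. by rewrite card_imset // => x y []. Qed.

Lemma arcs_subset sg A B : (arcs sg A \subset arcs sg B) = (A \subset B).
Proof.
apply/subsetP/subsetP => sAB => [x xA|[x y]].
  by have := sAB (x, sg x); rewrite !mem_arcs eqxx xA !andbT; apply.
by rewrite !mem_arcs => /andP[/sAB -> ->].
Qed.

Lemma subset_arcsE sg E : E \subset arcs sg setT -> E = arcs sg [set x | (x, sg x) \in E].
Proof.
move/subsetP => sE; apply/setP => -[x y]; rewrite mem_arcs inE.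
apply/idP/andP => [xy|[xy /eqP ->//]].
by have := sE _ xy; rewrite mem_arcs inE => /eqP eqy; rewrite -eqy.
Qed.

Lemma arcs_inj : injective (fun sg => arcs sg setT).
Proof.
move=> s1 s2 /setP eq12; apply/permP => x; apply/eqP.
by have := eq12 (x, s1 x); rewrite !mem_arcs !inE eqxx.
Qed.

Lemma porbit_image sg x y : (sg y \in porbit sg x) = (y \in porbit sg x).
Proof.
have := porbit_perm sg 1 y; rewrite expg1 => eqy.
by rewrite -!eq_porbit_mem eqy.
Qed.

Lemma component_sub_porbit sg A x : component_at (arcs sg A) x \subset porbit sg x.
Proof.
apply: component_sub_class => [|y z]; first exact: porbit_id.
by rewrite mem_arcs => /andP[_ /eqP ->]; rewrite porbit_image.
Qed.

Lemma component_arcsT sg x : component_at (arcs sg setT) x = porbit sg x.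
Proof.
apply/eqP; rewrite eqEsubset component_sub_porbit; apply/subsetP => _ /porbitP[i ->].
elim: i => [|i IH]; first by rewrite expg0 perm1 mem_component_at.
rewrite expgSr permM -(component_arc (component_at_components _ x) (x := (sg ^+ i)%g x)) //.
by rewrite mem_arcs inE /=.
Qed.

Lemma zip_traject (f : T -> T) x n :
  zip (traject f x n) (traject f (f x) n) = [seq (y, f y) | y <- traject f x n].
Proof. by elim: n x => //= n IH x; rewrite IH. Qed.

Lemma zip_traject_behead (f : T -> T) x n :
  zip (traject f x n.+1) (behead (traject f x n.+1)) =
  [seq (y, f y) | y <- traject f x n].
Proof. by elim: n x => //= n IH x; rewrite -IH. Qed.

Lemma arcs_cycle_cover D sg : arcs sg setT \subset D -> cycle_cover D (arcs sg setT).
Proof.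
move=> sD; rewrite /cycle_cover sD; apply/forall_inP => _ /imsetP[x _ ->].
rewrite -/(adjacent _) -/(component_at _ x) component_arcsT; apply/existsP.
pose s := traject sg x #|porbit sg x|.
have size_s : (size s <= #|T|)%N by rewrite size_traject max_card.
have mem_s y : (y \in s) = (y \in porbit sg x) by rewrite porbit_traject.
exists (Bseq size_s); rewrite /traces_path /traces_cycle /= -/s.
have [k card_x] : exists k, #|porbit sg x| = k.+1.
  by case: #|porbit sg x| (card_porbit_neq0 sg x) => // k _; exists k.
(* The trajectory closes up after a full orbit, so rotating it by one applies [sg] to each entry and
   the cyclic arcs become the pairs (y, sg y). *)
have rot_s : rot 1 s = traject sg (sg x) #|porbit sg x|.
  rewrite /s {1}card_x /= rot1_cons card_x trajectSr -iterSr -card_x.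
  by rewrite iter_porbit.
apply/and4P; split.
- by rewrite -size_eq0 size_traject card_x.
- exact: uniq_traject_porbit.
- by apply/eqP/setP => y; rewrite inE mem_s.
- apply/eqP/setP => -[y z]; rewrite rot_s zip_traject !inE /= mem_arcs inE /=.
  apply/andP/mapP => [[/eqP -> /andP[yx _]]|[u us [-> ->]]].
    by exists y; rewrite ?mem_s.
  by rewrite eqxx porbit_image -mem_s us.
Qed.

Definition functional E := forall x y y', (x, y) \in E -> (x, y') \in E -> y = y'.

Definition cofunctional E := forall x x' y, (x, y) \in E -> (x', y) \in E -> x = x'.

(** All arcs at a vertex lie in its component, where they pair the entries of two duplicate-free
    lists. The second list is [behead s] for paths and [rot 1 s] for cycles. *)
Lemma traced_functional E :
    (forall C, C \in components E ->
      exists s, exists t, [/\ uniq s, uniq t & E :&: setX C C = [set a in zip s t]]) ->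
  functional E /\ cofunctional E.
Proof.
move=> trE.
have mem_tr x y C : C \in components E -> x \in C -> (x, y) \in E ->
    (x, y) \in E :&: setX C C.
  by move=> compC xC xy; rewrite !inE xy -(component_arc compC xy) xC.
split=> [x y y' xy xy'|x x' y xy x'y].
  have compx := component_at_components E x.
  have [s [t [uniq_s _ eqE]]] := trE _ compx.
  have := mem_tr _ _ _ compx (mem_component_at E x) xy'.
  have := mem_tr _ _ _ compx (mem_component_at E x) xy.
  by rewrite eqE !inE; apply: zip_uniq_fst.
have compy := component_at_components E y.
have [s [t [_ uniq_t eqE]]] := trE _ compy.
have in_y z : (z, y) \in E -> z \in component_at E y.
  by move=> zy; rewrite (component_arc compy zy) mem_component_at.
have := mem_tr _ _ _ compy (in_y _ x'y) x'y.
have := mem_tr _ _ _ compy (in_y _ xy) xy.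
by rewrite eqE !inE; apply: zip_uniq_snd.
Qed.

(** In a cycle cover each vertex has an out-arc, and in- and out-arcs are unique; following the
    out-arcs is thus an injective self-map of a finite set, a permutation. *)
Lemma cycle_coverP D F :
  reflect (exists2 sg, F = arcs sg setT & arcs sg setT \subset D) (cycle_cover D F).
Proof.
apply: (iffP idP) => [coverF|[sg -> sD]]; last exact: arcs_cycle_cover.
case/andP: coverF => sFD /forall_inP coverF.
have [C compC|funF cofunF] := @traced_functional F.
  case/existsP: (coverF C compC) => s /and4P[_ uniq_s _ /eqP eqF].
  by exists s, (rot 1 s); rewrite rot_uniq.
have exF x : exists y, (x, y) \in F.
  have compx := component_at_components F x.
  case/existsP: (coverF _ compx) => s /and4P[_ _ /eqP eqC /eqP eqF].
  have xs : x \in s by have := mem_component_at F x; rewrite -eqC inE.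
  exists (nth x (rot 1 s) (index x s)).
  suff /setIP[] : (x, nth x (rot 1 s) (index x s)) \in
                  F :&: setX (component_at F x) (component_at F x) by [].
  rewrite eqF inE; apply/(mem_zipP x); exists (index x s).
  by rewrite size_rot !index_mem nth_index.
pose f x := xchoose (exF x).
have fP x : (x, f x) \in F := xchooseP (exF x).
have f_inj : injective f.
  by move=> x x' eq_f; apply: cofunF (fP x) _; rewrite eq_f.
have eqF : F = arcs (perm f_inj) setT.
  apply/setP => -[x y]; rewrite mem_arcs inE permE /=.
  by apply/idP/eqP => [xy|->//]; apply: funF xy (fP x).
by exists (perm f_inj); rewrite -?eqF.
Qed.

(** The path through [x] is found by walking back while the predecessor is in [A], then forward
    until a vertex outside [A]. Both walks stop because the orbit leaves [A]. *)
Lemma arcs_path_cover D sg A :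
    arcs sg A \subset D -> (forall x, exists2 y, y \in porbit sg x & y \notin A) ->
  path_cover D (arcs sg A).
Proof.
move=> sD acyclic; rewrite /path_cover sD; apply/forall_inP => _ /imsetP[x _ ->].
rewrite -/(adjacent _) -/(component_at _ x); apply/existsP.
(* If the orbit element outside [A] is [x] itself, going back once around the whole orbit reaches it
   after a positive number of steps. *)
have exb : exists k, (sg ^- k.+1)%g x \notin A.
  have [y] := acyclic x; rewrite -porbitV => /porbitP[[|i] ->] yA.
    have [k eqk] : exists k, #|porbit (sg^-1)%g x| = k.+1.
      by case: #|_| (card_porbit_neq0 (sg^-1)%g x) => // k _; exists k.
    exists k; rewrite -expgVn permX -eqk iter_porbit.
    by rewrite expg0 perm1 in yA.
  by exists i; rewrite -expgVn.
case: (ex_minnP exb) => k k_notA k_min {exb}.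
pose f := (sg ^- k)%g x.
have xf : x = iter k sg f by rewrite -permX permKV.
have fV : (sg^-1)%g f \notin A by rewrite -permM -expgVn -expgSr expgVn.
have exl : exists l, iter l sg f \notin A.
  by have [y /porbitP[i ->] yA] := acyclic f; exists i; rewrite -permX.
case: (ex_minnP exl) => l l_notA l_min {exl}.
have inA i : (i < l)%N -> iter i sg f \in A.
  by move=> lt_il; apply: contraLR lt_il => /l_min; rewrite -leqNgt.
(* The forward walk from [f] reaches [x] before stopping: a vertex outside [A] strictly before [x]
   would contradict the minimality of [k]. *)
have lt_kl : (k <= l)%N.
  rewrite leqNgt; apply/negP => lt_lk.
  have := k_min (k - l.+1)%N; rewrite -subSn // subSS leqNgt.
  have -> : (sg ^- (k - l))%g x = iter l sg f.
    rewrite xf -(subnK (ltnW lt_lk)) addnK iterD -!permX.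
    by rewrite permK.
  by move/(_ l_notA); rewrite -leqNgt leqNgt ltn_subrL (leq_ltn_trans _ lt_lk).
pose s := traject sg f l.+1.
(* A repetition would bring the walk back to [f] from a vertex of [A], but the predecessor of [f] is
   outside [A]. *)
have uniq_s : uniq s.
  rewrite looping_uniq; apply/trajectP => -[i lt_i].
  rewrite -(subnK (ltnW lt_i)) addnC iterD -!permX => /perm_inj.
  rewrite permX -[(l - i)%N]prednK ?subn_gt0 // iterS => eq_f.
  by have := fV; rewrite -eq_f permK inA // prednK ?subn_gt0 // leq_subr.
have size_s : (size s <= #|T|)%N by rewrite -(card_uniqP uniq_s) max_card.
have arc_s i : (i < l)%N -> (iter i sg f, iter i.+1 sg f) \in arcs sg A.
  by move=> lt_i; rewrite mem_arcs inA //=.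
have in_comp i : (i <= l)%N -> iter i sg f \in component_at (arcs sg A) f.
  elim: i => [|i IH] le_il; first by rewrite mem_component_at.
  rewrite -(component_arc (component_at_components _ _) (arc_s i le_il)).
  exact/IH/ltnW.
have compf : component_at (arcs sg A) x = component_at (arcs sg A) f.
  by apply: component_at_eq; rewrite xf in_comp.
(* Nothing enters [f] and nothing leaves the last entry, so no arc crosses the boundary of [s], and
   [s] exhausts the component. *)
have closed_s y z : (y, z) \in arcs sg A -> (y \in s) = (z \in s).
  rewrite mem_arcs => /andP[yA /eqP ->]; apply/trajectP/trajectP => -[i lt_i eq_i].
    rewrite eq_i in yA *; exists i.+1 => //.
    by rewrite ltnS ltn_neqAle -ltnS lt_i andbT; apply: contraTneq yA => ->.
  case: i lt_i eq_i => [|i] lt_i /= eq_i.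
    by have := fV; rewrite -[f]eq_i permK yA.
  by exists i; [exact: ltnW | exact: perm_inj eq_i].
have mem_s y : (y \in s) = (y \in component_at (arcs sg A) x).
  apply/idP/idP => [/trajectP[i]|]; last first.
    rewrite compf; apply: subsetP y; apply: component_sub_class closed_s.
    exact: mem_head.
  by rewrite ltnS compf => le_il ->; apply: in_comp.
have zip_s : zip s (behead s) = [seq (y, sg y) | y <- traject sg f l].
  exact: zip_traject_behead.
exists (Bseq size_s); rewrite -[bseqval _]/s; apply/and4P; split=> //.
- by apply/eqP/setP => y; rewrite inE mem_s.
- apply/eqP/setP => -[y z]; rewrite zip_s in_setI in_setX /= -!mem_s mem_arcs [RHS]inE.
  apply/andP/mapP => [[/andP[yA /eqP ->] /andP[/trajectP[i lt_i eq_y] _]]|].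
    exists y => //; rewrite eq_y; apply/trajectP; exists i => //.
    by rewrite ltn_neqAle -ltnS lt_i andbT; apply: contraTneq yA => eq_i; rewrite eq_y eq_i.
  case=> u /trajectP[i lt_i ->] [-> ->]; rewrite inA // eqxx /=.
  split=> //; apply/andP; split; apply/trajectP; first by exists i => //; exact: ltnW.
  by exists i.+1.
Qed.

End PermutationArcs.

(** * The quotient by a path cover *)

(** Both images are in bijection with the classes of the common kernel. This compares the cycle
    counts of permutations of different sets. *)
Lemma card_imset_same_kernel (A B1 B2 : finType) (f : A -> B1) (g : A -> B2) :
    (forall x y, f x = f y <-> g x = g y) ->
  #|[set f x | x : A]| = #|[set g x | x : A]|.
Proof.
move=> ker_fg.
have leq_im (C1 C2 : finType) (u : A -> C1) (v : A -> C2) :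
    (forall x y, u x = u y -> v x = v y) -> (#|[set v x | x : A]| <= #|[set u x | x : A]|)%N.
  have some_inj : injective (@Some C2) by move=> ? ? [].
  (* [w] maps a value of [u] to the value of [v] at any preimage; it lands in an option type because
     [c] may have no preimage. *)
  move=> ker_uv; pose w c := omap v [pick x | u x == c].
  rewrite -(card_imset _ some_inj) (leq_trans _ (leq_imset_card w _)) //.
  apply/subset_leq_card/subsetP => _ /imsetP[_ /imsetP[x _ ->] ->].
  apply/imsetP; exists (u x); first exact: imset_f.
  rewrite /w; case: pickP => [y /eqP/ker_uv /= -> //|/(_ x)].
  by rewrite eqxx.
by apply/eqP; rewrite eqn_leq !leq_im // => x y /ker_fg.
Qed.

Section PathCoverQuotient.
Variables (T : finType) (D E : {set T * T}).
Hypothesis coverE : path_cover D E.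
Implicit Types (A C : {set T}) (s : seq T) (sg : {perm T}).

Definition is_first x := [forall y, (y, x) \notin E].
Definition is_last x := [forall y, (x, y) \notin E].

Lemma path_cover_trace C : C \in components E ->
  exists s : #|T|.-bseq T, traces_path E C s.
Proof. by case/andP: coverE => _ /forall_inP coverC /coverC/existsP. Qed.

Lemma path_cover_sub : E \subset D. Proof. by case/andP: coverE. Qed.

Lemma path_cover_functional : functional E /\ cofunctional E.
Proof.
apply: traced_functional => C /path_cover_trace[s /and4P[_ uniq_s _ /eqP eqE]].
by exists s, (behead s); split; rewrite // -drop1 drop_uniq.
Qed.

Lemma traces_path_arc C s i x0 : traces_path E C s -> (i.+1 < size s)%N ->
  (nth x0 s i, nth x0 s i.+1) \in E.
Proof.
case/and4P => _ _ _ /eqP eqE lt_i.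
suff /setIP[] : (nth x0 s i, nth x0 s i.+1) \in E :&: setX C C by [].
rewrite eqE inE; apply/(mem_zipP x0); exists i; rewrite (ltnW lt_i) nth_behead.
by rewrite size_behead -ltnS (ltn_predK lt_i).
Qed.

Lemma traces_path_arcP C s x y x0 : C \in components E -> traces_path E C s ->
    (x, y) \in E -> x \in C ->
  exists i, [/\ (i.+1 < size s)%N, x = nth x0 s i & y = nth x0 s i.+1].
Proof.
move=> compC /and4P[_ _ _ /eqP eqE] xy xC.
have : (x, y) \in E :&: setX C C.
  by rewrite in_setI in_setX xy -(component_arc compC xy) xC.
rewrite eqE inE => /(mem_zipP x0)[i [_ lt_i -> ->]]; exists i.
rewrite nth_behead; split=> //; move: lt_i; rewrite size_behead.
by case: (size s).
Qed.

(** Each later entry receives an arc from the entry before it, while an arc into the head would make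
    the head reappear further on. Path ends thus become a local condition, free of the choice of
    [s]. *)
Lemma traces_path_head C s x : C \in components E -> traces_path E C s ->
  (head x s == x) = (x \in C) && is_first x.
Proof.
move=> compC trs; have /and4P[s0 uniq_s /eqP eqC _] := trs.
have memC y : (y \in C) = (y \in s) by rewrite -eqC inE.
case: s => // z s in trs s0 uniq_s eqC memC *.
apply/eqP/andP => [/= <-|[]].
  split; first by rewrite memC mem_head.
  apply/forallP => y; apply/negP => yz.
  have yC : y \in C by rewrite (component_arc compC yz) memC mem_head.
  have [i [lt_i _ eqz]] := traces_path_arcP z compC trs yz yC.
  have := @nth_uniq _ z (z :: s) 0 i.+1 isT lt_i uniq_s.
  by rewrite -eqz /= eqxx.
rewrite memC => /(nthP z)[[//|i] lt_i <-] /forallP/(_ (nth z (z :: s) i)).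
by rewrite (traces_path_arc _ trs).
Qed.

Lemma traces_path_last C s x : C \in components E -> traces_path E C s ->
  (last x s == x) = (x \in C) && is_last x.
Proof.
move=> compC trs; have /and4P[s0 uniq_s /eqP eqC _] := trs.
have memC y : (y \in C) = (y \in s) by rewrite -eqC inE.
have size_gt0 : (0 < size s)%N by rewrite lt0n size_eq0.
rewrite -nth_last; apply/eqP/andP => [eqx|[]].
  have xC : x \in C by rewrite memC -eqx mem_nth // prednK.
  split=> //; apply/forallP => y; apply/negP => xy.
  have [i [lt_i eqx' _]] := traces_path_arcP x compC trs xy xC.
  have lt_p : ((size s).-1 < size s)%N by rewrite prednK.
  have /esym := nth_uniq x lt_p (ltnW lt_i) uniq_s.
  by rewrite eqx -eqx' eqxx => /eqP eqi; move: lt_i; rewrite -eqi prednK // ltnn.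
rewrite memC => /(nthP x)[i lt_i eqx] /forallP/(_ (nth x s i.+1)) no_out.
have [lt_i1|] := ltnP i.+1 (size s).
  by have := traces_path_arc x trs lt_i1; rewrite eqx (negPf no_out).
by move=> le_i; rewrite -[RHS]eqx; congr nth; apply/eqP; rewrite -eqSS prednK // eqn_leq le_i.
Qed.

Lemma first_vertexE C x : C \in components E ->
  first_vertex E C x = (x \in C) && is_first x.
Proof.
move=> compC; apply/existsP/idP => [[s /andP[trs]]|first_x].
  by rewrite (traces_path_head _ compC trs).
have [s trs] := path_cover_trace compC.
by exists s; rewrite trs (traces_path_head _ compC trs).
Qed.

Lemma last_vertexE C x : C \in components E ->
  last_vertex E C x = (x \in C) && is_last x.
Proof.
move=> compC; apply/existsP/idP => [[s /andP[trs]]|last_x].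
  by rewrite (traces_path_last _ compC trs).
have [s trs] := path_cover_trace compC.
by exists s; rewrite trs (traces_path_last _ compC trs).
Qed.

Lemma component_nonempty (C : component E) : exists x, x \in val C.
Proof.
by case: C => C /= /imsetP[x _ ->]; exists x; rewrite inE connect0.
Qed.

Lemma ex_first (C : component E) : exists x, (x \in val C) && is_first x.
Proof.
have [x xC] := component_nonempty C; have [s trs] := path_cover_trace (valP C).
exists (head x s); rewrite -(traces_path_head _ (valP C) trs).
by case/and4P: trs; case: (bseqval s).
Qed.

Lemma ex_last (C : component E) : exists x, (x \in val C) && is_last x.
Proof.
have [x xC] := component_nonempty C; have [s trs] := path_cover_trace (valP C).
exists (last x s); rewrite -(traces_path_last _ (valP C) trs).
by case/and4P: trs; case: (bseqval s) => //= y t _ _ _ _.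
Qed.

Implicit Types (P : component E) (tau : {perm component E}).

Definition firstv P := xchoose (ex_first P).
Definition lastv P := xchoose (ex_last P).
Definition component_of x : component E := Sub (component_at E x) (component_at_components E x).

Lemma component_ofE P x : x \in val P -> component_of x = P.
Proof. by move=> xC; apply: val_inj; rewrite /= -(componentsE (valP P) xC). Qed.

Lemma component_of_firstv P : component_of (firstv P) = P.
Proof. by case/andP: (xchooseP (ex_first P)) => /component_ofE. Qed.

Lemma component_of_lastv P : component_of (lastv P) = P.
Proof. by case/andP: (xchooseP (ex_last P)) => /component_ofE. Qed.

Lemma firstvP P : is_first (firstv P).
Proof. by case/andP: (xchooseP (ex_first P)). Qed.

Lemma lastvP P : is_last (lastv P).
Proof. by case/andP: (xchooseP (ex_last P)). Qed.

Lemma firstv_component_of x : is_first x -> firstv (component_of x) = x.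
Proof.
move=> first_x; have compC := component_at_components E x.
have [s trs] := path_cover_trace compC.
have := traces_path_head x compC trs; rewrite mem_component_at first_x => /eqP eqx; rewrite -[RHS]eqx {eqx}.
have := traces_path_head (firstv (component_of x)) compC trs.
have -> : (firstv (component_of x) \in component_at E x) && is_first (firstv (component_of x)).
  exact: (xchooseP (ex_first (component_of x))).
by move/eqP; case/and4P: trs => + _ _ _; case: (bseqval s).
Qed.

Lemma lastv_component_of x : is_last x -> lastv (component_of x) = x.
Proof.
move=> last_x; have compC := component_at_components E x.
have [s trs] := path_cover_trace compC.
have := traces_path_last x compC trs; rewrite mem_component_at last_x => /eqP eqx; rewrite -[RHS]eqx {eqx}.
have := traces_path_last (lastv (component_of x)) compC trs.
have -> : (lastv (component_of x) \in component_at E x) && is_last (lastv (component_of x)).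
  exact: (xchooseP (ex_last (component_of x))).
by move/eqP; case/and4P: trs => + _ _ _; case: (bseqval s).
Qed.

Lemma mem_quotient_digraph P P' :
  ((P, P') \in quotient_digraph D E) = ((lastv P, firstv P') \in D).
Proof.
rewrite inE /=; apply/existsP/idP => [[x /existsP[y /and3P[]]]|].
  rewrite last_vertexE ?(valP P) // first_vertexE ?(valP P') //.
  by move=> /andP[/component_ofE <- /lastv_component_of ->] /andP[/component_ofE <- /firstv_component_of ->].
move=> arc; exists (lastv P); apply/existsP; exists (firstv P').
rewrite last_vertexE ?(valP P) // first_vertexE ?(valP P') //.
by rewrite !(xchooseP (ex_last P), xchooseP (ex_first P')).
Qed.

(** Vertices with an out-arc correspond to the arcs, and those without one are the last vertices,
    one for each path. *)
Lemma card_path_cover : (#|E| + #|components E| = #|T|)%N.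
Proof.
have [funE _] := path_cover_functional.
have <- : #|[set a.1 | a in E]| = #|E|.
  by apply: card_in_imset => -[x y] [x' y'] /= xy + eqx; rewrite -eqx => /(funE _ _ _ xy) ->.
have -> : #|components E| = #|[set lastv P | P : component E]|.
  rewrite [RHS]card_imset; last exact: can_inj component_of_lastv.
  by rewrite card_sig; apply: eq_card.
rewrite -[RHS](cardsC [set a.1 | a in E]); congr (_ + _)%N.
apply: eq_card => x; rewrite inE; apply/imsetP/idP => [[P _ ->]|].
  apply/imsetP => -[[y z] yz /= eqy]; have /forallP/(_ z) := lastvP P.
  by rewrite eqy yz.
move=> no_out; exists (component_of x) => //; rewrite lastv_component_of //.
apply/forallP => y; apply: contra no_out => xy.
by apply/imsetP; exists (x, y).
Qed.

(** The default [x] is returned only at last vertices, where [lift_fun] does not call it. *)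
Definition successor x := odflt x [pick y | (x, y) \in E].

Lemma successorE x y : (x, y) \in E -> successor x = y.
Proof.
move=> xy; rewrite /successor; case: pickP => [z xz|/(_ y)]; last by rewrite xy.
exact: (path_cover_functional.1 _ _ _ xz xy).
Qed.

Lemma not_is_last x : ~~ is_last x -> (x, successor x) \in E.
Proof.
by rewrite negb_forall => /existsP[y]; rewrite negbK => xy; rewrite (successorE xy).
Qed.

(** This glues the paths of [E] end to end in the cyclic order prescribed by [tau]. *)
Definition lift_fun (tau : {perm component E}) x :=
  if is_last x then firstv (tau (component_of x)) else successor x.

Lemma lift_fun_inj tau : injective (lift_fun tau).
Proof.
(* A jump lands on a first vertex, which no arc of [E] enters, so jumps and steps inside paths never
   collide. *)
have mixed P y : ~~ is_last y -> firstv P <> successor y.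
  by move/not_is_last => arc eq_y; have /forallP/(_ y) := firstvP P; rewrite eq_y arc.
move=> x y; rewrite /lift_fun; case: ifPn => lx; case: ifPn => ly.
- move/(congr1 component_of); rewrite !component_of_firstv => /perm_inj/(congr1 lastv).
  by rewrite !lastv_component_of.
- by move/mixed => /(_ ly).
- by move/esym/mixed => /(_ lx).
- have xa := not_is_last lx; have ya := not_is_last ly => eqxy.
  by rewrite eqxy in xa; apply: (path_cover_functional.2 _ _ _ xa ya).
Qed.

Definition lift_perm_cover tau : {perm T} := perm (@lift_fun_inj tau).

Lemma lift_arc tau x y : (x, y) \in E -> lift_perm_cover tau x = y.
Proof.
move=> xy; rewrite permE /lift_fun ifN ?(successorE xy) //.
by apply/forallPn; exists y; rewrite negbK.
Qed.

Lemma lift_lastv tau P : lift_perm_cover tau (lastv P) = firstv (tau P).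
Proof. by rewrite permE /lift_fun lastvP component_of_lastv. Qed.

Lemma lift_inj : injective lift_perm_cover.
Proof.
move=> t1 t2 eq12; apply/permP => P; rewrite -[LHS]component_of_firstv -[RHS]component_of_firstv.
by rewrite -!lift_lastv eq12.
Qed.

Lemma lift_sub tau : E \subset arcs (lift_perm_cover tau) setT.
Proof. by apply/subsetP => -[x y] xy; rewrite mem_arcs inE (lift_arc tau xy) /=. Qed.

(** The lift uses arcs of [E], already in [D], and jumps from a last to a first vertex, which are
    exactly what the quotient records. *)
Lemma lift_arcs_sub tau :
  (arcs (lift_perm_cover tau) setT \subset D) =
  (arcs tau setT \subset quotient_digraph D E).
Proof.
apply/subsetP/subsetP => [sD [P P']|sQ [x y]].
  rewrite mem_arcs inE => /eqP ->; rewrite mem_quotient_digraph -lift_lastv.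
  by apply: sD; rewrite mem_arcs inE /=.
rewrite mem_arcs inE => /eqP ->; have [last_x|] := boolP (is_last x).
  rewrite -(lastv_component_of last_x) lift_lastv -mem_quotient_digraph.
  by apply: sQ; rewrite mem_arcs inE /=.
move/not_is_last => arc; rewrite (lift_arc tau arc).
exact: subsetP path_cover_sub _ arc.
Qed.

(** A permutation extending [E] sends last vertices to first ones: an arc of [E] into [sg x] could
    start only at [x]. Hence it permutes the paths. *)
Lemma lift_surj sg : E \subset arcs sg setT -> exists tau, sg = lift_perm_cover tau.
Proof.
move=> /subsetP sE.
have sg_arc x y : (x, y) \in E -> sg x = y.
  by move/sE; rewrite mem_arcs inE => /eqP.
have first_sg x : is_last x -> is_first (sg x).
  move=> last_x; apply/forallP => y; apply/negP => yx.
  have /perm_inj eqy := sg_arc _ _ yx; rewrite eqy in yx.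
  by have /forallP/(_ (sg x)) := last_x; rewrite yx.
pose f P := component_of (sg (lastv P)).
have f_inj : injective f.
  move=> P P' /(congr1 firstv); rewrite !firstv_component_of ?first_sg ?lastvP //.
  by move/perm_inj/(congr1 component_of); rewrite !component_of_lastv.
exists (perm f_inj); apply/permP => x; rewrite permE /lift_fun permE /f.
case: ifPn => [last_x|/not_is_last arc]; last exact: sg_arc.
by rewrite lastv_component_of // firstv_component_of ?first_sg.
Qed.

Lemma porbit_component sg x y : E \subset arcs sg setT ->
  component_of x = component_of y -> porbit sg x = porbit sg y.
Proof.
move=> /subset_arcsE eqE /(congr1 val) /= eqxy; apply/eqP; rewrite eq_porbit_mem.
have := subsetP (component_sub_porbit sg [set x | (x, sg x) \in E] y); rewrite -eqE.
by apply; rewrite -eqxy mem_component_at.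
Qed.

Lemma card_porbits_lift tau : #|porbits (lift_perm_cover tau)| = #|porbits tau|.
Proof.
set sg := lift_perm_cover tau; have sE := lift_sub tau.
(* Each path lies inside one orbit, so every orbit contains a first vertex. *)
have -> : porbits sg = [set porbit sg (firstv P) | P : component E].
  apply/setP => O; apply/imsetP/imsetP => -[z _ ->]; last by exists (firstv z).
  by exists (component_of z) => //; apply: porbit_component => //; rewrite component_of_firstv.
apply: card_imset_same_kernel => P P'; split=> /eqP; rewrite eq_porbit_mem.
  case/porbitP => i eqC; apply/eqP; rewrite eq_porbit_mem -(component_of_firstv P) eqC.
  (* Along the lifted permutation, the current path is unchanged by arcs of [E] and moves by [tau]
     at a last vertex. *)
  elim: i {P eqC} => [|i IH]; first by rewrite expg0 perm1 component_of_firstv porbit_id.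
  rewrite expgSr permM; set x := (sg ^+ i)%g _ in IH *.
  have [last_x|/not_is_last arc] := boolP (is_last x).
    by rewrite -(lastv_component_of last_x) lift_lastv component_of_firstv porbit_image.
  suff -> : component_of (sg x) = component_of x by [].
  by apply: val_inj; rewrite /= (lift_arc tau arc) -(component_at_arc arc).
(* Conversely one step of [tau] stays in the lifted orbit, since the first and last vertices of a
   path lie in the same orbit. *)
case/porbitP => i ->; elim: i => [|i IH]; first by rewrite expg0 perm1.
rewrite -[RHS]IH expgSr permM; set P1 := (tau ^+ i)%g _.
rewrite -lift_lastv; apply/eqP; rewrite eq_porbit_mem porbit_image -eq_porbit_mem.
by apply/eqP/porbit_component => //; rewrite component_of_lastv component_of_firstv.
Qed.

(** Lifting is a bijection preserving the number of cycles. [G] will be constant for e and a sign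
    for h. *)
Lemma sum_extensions (R : nmodType) (G : nat -> R) :
  \sum_(sg : {perm T} | (E \subset arcs sg setT) && (arcs sg setT \subset D))
     G #|porbits sg| =
  \sum_(tau : {perm component E} | arcs tau setT \subset quotient_digraph D E)
     G #|porbits tau|.
Proof.
rewrite -[RHS]big_set; under [RHS]eq_bigr do rewrite -card_porbits_lift.
rewrite -(big_imset (h := lift_perm_cover) (fun sg => G #|porbits sg|)) /=; last first.
  by move=> t1 t2 _ _; apply: lift_inj.
apply: eq_bigl => sg; apply/andP/imsetP => [[sE sD]|[tau]].
  have [tau eq_sg] := lift_surj sE; exists tau => //.
  by rewrite inE -lift_arcs_sub -eq_sg.
by rewrite inE -lift_arcs_sub => sD ->; rewrite lift_sub.
Qed.

End PathCoverQuotient.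

(** * Expansion of the cycle symmetric function *)

Section CycleExpansion.
Variables (T : finType) (sg : {perm T}).
Implicit Types (D E : {set T * T}) (A O : {set T}).

(** The first vertex of a path has its [sg]-predecessor outside [A], so no orbit lies in [A]; the
    converse is [arcs_path_cover]. *)
Lemma path_cover_arcs D A : arcs sg A \subset D ->
  path_cover D (arcs sg A) = [forall O in porbits sg, ~~ (O \subset A)].
Proof.
move=> sD; apply/idP/forall_inP => [coverA _ /imsetP[x _ ->]|acyclic].
  pose y := firstv coverA (component_of (arcs sg A) x).
  have /andP[] := xchooseP (ex_first coverA (component_of (arcs sg A) x)).
  rewrite -/(firstv coverA _) -/y => /(subsetP (component_sub_porbit _ _ _)) yx.
  move=> /forallP/(_ (sg^-1 y)%g); rewrite mem_arcs permKV eqxx andbT.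
  by apply/contraNN => /subsetP; apply; rewrite -porbit_image permKV.
apply: arcs_path_cover sD _ => x.
by apply/subsetPn/acyclic/imset_f.
Qed.

(** Both sides have the same sum over all vertices, so the termwise inequalities are equalities. *)
Lemma weakly_monotone_constant (c : T -> nat) :
  (forall x, c x <= c (sg x))%N -> forall x, c x = c (sg x).
Proof.
move=> mono_c x; have := leqif_sum (fun x (_ : true) => leqif_eq (mono_c x)).
rewrite -(reindex_inj (@perm_inj _ sg) (P := xpredT) (F := c)) => -[_ /esym].
by rewrite eqxx => /forallP/(_ x)/eqP.
Qed.

(** A minimum of [c] on the orbit is such a vertex. *)
Lemma porbit_weak_ascent (c : T -> nat) x :
  exists2 y, y \in porbit sg x & (c y <= c (sg y))%N.
Proof.
case: (@arg_minnP _ x (fun y => y \in porbit sg x) c (porbit_id sg x)) => y yx min_y.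
by exists y => //; apply: min_y; rewrite /= porbit_image.
Qed.

Lemma signed_sum_strict_ascents D (c : T -> nat) : arcs sg setT \subset D ->
  \sum_(A | path_cover D (arcs sg A) && [forall a in arcs sg A, (c a.1 < c a.2)%N])
     (-1) ^+ #|A| = [forall a in arcs sg setT, c a.1 == c a.2]%:R :> int.
Proof.
move=> sD; pose asc := [set x | c x < c (sg x)]%N.
rewrite (eq_bigl (fun A => A \subset asc)) => [|A]; last first.
  have sAD : arcs sg A \subset D by rewrite (subset_trans _ sD) ?arcs_subset ?subsetT.
  rewrite path_cover_arcs //; apply/andP/subsetP => [[_ /forall_inP incr] x xA|incr].
    by rewrite inE; apply: (incr (x, sg x)); rewrite mem_arcs xA eqxx.
  split; last first.
    apply/forall_inP => -[x y]; rewrite mem_arcs => /andP[/incr + /eqP ->].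
    by rewrite inE.
  apply/forall_inP => _ /imsetP[x _ ->]; apply/negP => /subsetP sxA.
  (* An orbit made of strict ascents would increase past its maximum; so every set of strict ascents
     gives a path cover. *)
  case: (@arg_maxnP _ x (fun y => y \in porbit sg x) c (porbit_id sg x)) => y yx max_y.
  have := incr y (sxA y yx); rewrite inE ltnNge => /negP; apply; apply: max_y.
  by rewrite porbit_image.
rewrite signed_sum_subsets; congr (_ : bool)%:R; apply/eqP/forall_inP => [asc0|const].
  move=> [x y]; rewrite mem_arcs inE => /eqP -> /=; apply/eqP.
  (* Without strict ascents [c] weakly decreases along [sg]; subtracting it from [M] gives a weakly
     increasing function. *)
  pose M := (\max_x c x)%N.
  have le_M z : (c z <= M)%N by apply: leq_bigmax.
  have := @weakly_monotone_constant (fun z => M - c z)%N _ x => eqM.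
  have {eqM} : (M - c x = M - c (sg x))%N.
    apply: eqM => z; apply: leq_sub2l; rewrite leqNgt.
    by have := in_set0 z; rewrite -asc0 inE => ->.
  by move/(congr1 (subn M)); rewrite !subKn.
apply/setP => x; rewrite !inE; apply/negbTE; rewrite -leqNgt.
by have := const (x, sg x); rewrite mem_arcs inE eqxx => /(_ isT)/eqP /= <-.
Qed.

(** Inclusion-exclusion over sets [K] of orbits contained in [A] replaces the path cover condition.
    The sum over [A] then vanishes unless the weak ascents are exactly the union of [K]. Every orbit
    has a weak ascent, so [K] must be all orbits, and then [c] is constant on them. *)
Lemma signed_sum_weak_ascents D (c : T -> nat) : arcs sg setT \subset D ->
  \sum_(A | path_cover D (arcs sg A) && [forall a in arcs sg A, (c a.1 <= c a.2)%N])
     (-1) ^+ #|A| =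
  [forall a in arcs sg setT, c a.1 == c a.2]%:R * (-1) ^+ (#|T| + #|porbits sg|) :> int.
Proof.
move=> sD; pose asc := [set x | c x <= c (sg x)]%N.
(* The product of the factors [F A O + 1] is 0 if some orbit lies in [A] and 1 otherwise; its
   expansion is the sum over [K]. *)
pose F A O : int := if (O \in porbits sg) && (O \subset A) then -1 else 0.
transitivity (\sum_(A : {set T} | A \subset asc)
    \sum_(K : {set {set T}} | (K \subset porbits sg) && (cover K \subset A))
      (-1) ^+ #|K| * (-1) ^+ #|A| : int).
  rewrite (eq_bigl (fun A => (A \subset asc) &&
             [forall O in porbits sg, ~~ (O \subset A)])) => [|A]; last first.
    have sAD : arcs sg A \subset D by rewrite (subset_trans _ sD) ?arcs_subset ?subsetT.
    rewrite path_cover_arcs // andbC; congr (_ && _).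
    apply/forall_inP/subsetP => [incr x xA|incr [x y]].
      by rewrite inE; apply: (incr (x, sg x)); rewrite mem_arcs xA eqxx.
    by rewrite mem_arcs => /andP[/incr + /eqP ->]; rewrite inE.
  rewrite big_mkcondr; apply: eq_bigr => A _; rewrite -mulr_suml.
  have -> : \sum_(K : {set {set T}} | (K \subset porbits sg) && (cover K \subset A))
              (-1) ^+ #|K| = \prod_O (F A O + 1) :> int.
    rewrite bigA_distr [LHS]big_mkcond; apply: eq_bigr => K _.
    case: ifPn => [/andP[/subsetP sK /bigcupsP sKA]|].
      rewrite -sum1_card -prodrXr big_mkcond; apply: eq_bigr => O _.
      by case: ifPn => // OK; rewrite /F sK // sKA.
    rewrite negb_and => noK.
    have [O OK FO] : exists2 O, O \in K & ~~ ((O \in porbits sg) && (O \subset A)).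
      case/orP: noK => [/subsetPn[O OK nO]|]; first by exists O; rewrite // (negPf nO).
      case/subsetPn => x /bigcupP[O OK xO] xA; exists O => //.
      by rewrite negb_and; apply/orP; right; apply/subsetPn; exists x.
    by rewrite (bigD1 O) //= OK /F (negPf FO) mul0r.
  case: ifPn => [/forall_inP acyclic|].
    rewrite big1 ?mul1r // => O _; rewrite /F.
    by case: ifP => [/andP[/acyclic/negPf ->]|_]; rewrite ?add0r.
  case/forall_inPn => O Oorb; rewrite negbK => sOA.
  by rewrite (bigD1 O) //= /F [O \in _]Oorb sOA addNr !mul0r.
rewrite (exchange_big_dep (fun K : {set {set T}} => K \subset porbits sg)) /=; last by move=> A K _ /andP[].
under eq_bigr => K sK.
  rewrite (eq_bigl (fun A : {set T} => (cover K \subset A) && (A \subset asc))).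
    rewrite -mulr_sumr signed_sum_interval.
    over.
  by move=> A; rewrite sK andbC.
have covK (K : {set {set T}}) : K \subset porbits sg -> asc = cover K -> K = porbits sg.
  move=> /subsetP sK eq_asc; apply/eqP; rewrite eqEsubset; apply/andP; split; first exact/subsetP.
  apply/subsetP => _ /imsetP[x _ ->].
  have [y yx asc_y] := porbit_weak_ascent c x.
  have : y \in asc by rewrite inE.
  rewrite eq_asc => /bigcupP[O OK yO]; have /imsetP[z _ eqO] := sK _ OK.
  rewrite eqO in yO OK; suff -> : porbit sg x = porbit sg z by [].
  apply/eqP; rewrite eq_sym; move: yx yO; rewrite -!eq_porbit_mem => /eqP <- /eqP <-.
  by [].
have cover_porbits : cover (porbits sg) = setT.
  apply/setP => x; rewrite inE; apply/bigcupP; exists (porbit sg x).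
    exact: imset_f. exact: porbit_id.
rewrite (bigD1 (porbits sg)) //= big1 => [|K /andP[sK neqK]]; last first.
  by case: eqP => [/(covK K sK)/eqP|_]; rewrite ?(negPf neqK) // mul0r mulr0.
rewrite addr0 cover_porbits mulrCA.
have <- : (asc == setT) = [forall a in arcs sg setT, c a.1 == c a.2].
  apply/eqP/forall_inP => [ascT [x y]|const].
    rewrite mem_arcs inE => /eqP -> /=; apply/eqP/weakly_monotone_constant => z.
    by have := in_setT z; rewrite -ascT inE.
  apply/setP => x; rewrite !inE; have := const (x, sg x).
  by rewrite mem_arcs inE eqxx => /(_ isT)/eqP /= <-; rewrite leqnn.
case: eqP => [->|_]; last by rewrite !mul0r.
by rewrite !mul1r cardsT -exprD addnC.
Qed.

Lemma sum_sub_arcs (R : nmodType) (P : pred {set T * T}) (G : {set T * T} -> R) :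
  \sum_(E | P E && (E \subset arcs sg setT)) G E =
  \sum_(A | P (arcs sg A)) G (arcs sg A).
Proof.
rewrite (reindex_onto (arcs sg) (fun E => [set x | (x, sg x) \in E])) => [|E] /=.
  apply: eq_bigl => A; rewrite arcs_subset subsetT andbT andb_idr // => _.
  by apply/eqP/setP => x; rewrite inE mem_arcs eqxx andbT.
by case/andP => _ /subset_arcsE <-.
Qed.

(** After exchanging the sums over path covers and colourings, the signed sum keeps only the
    colourings constant along the cycles, each weighted by [eps]; these add up to the power sum. *)
Lemma colour_expansion D m (b : seq nat -> symfun) (r : rel nat) (eps : int) :
    arcs sg setT \subset D ->
    (forall E, path_cover D E -> b (digraph_type E) m =
       \sum_(c : {ffun T -> 'I_m} | [forall a in E, r (c a.1) (c a.2)]) \prod_x 'X_(c x)) ->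
    (forall c : T -> nat,
       \sum_(A | path_cover D (arcs sg A) && [forall a in arcs sg A, r (c a.1) (c a.2)])
         (-1) ^+ #|A| = [forall a in arcs sg setT, c a.1 == c a.2]%:R * eps) ->
  eps *: power_sum (digraph_type (arcs sg setT)) m =
  \sum_(E | path_cover D E && (E \subset arcs sg setT))
     (-1) ^+ #|E| *: b (digraph_type E) m.
Proof.
move=> sD bE signed_sum; rewrite sum_sub_arcs.
under [RHS]eq_bigr => A coverA do rewrite bE // card_arcs scaler_sumr.
rewrite (exchange_big_dep xpredT) //= (power_sum_colourings m (arcs_cycle_cover sD)).
rewrite big_mkcond scaler_sumr; apply: eq_bigr => c _.
rewrite -scaler_suml (signed_sum (fun x => c x)).
have -> : [forall a in arcs sg setT, c a.1 == c a.2 :> nat] =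
          [forall a in arcs sg setT, c a.1 == c a.2].
  by apply: eq_forallb => a; rewrite val_eqE.
by case: ifP => _; rewrite ?mul1r // mul0r scale0r scaler0.
Qed.

End CycleExpansion.

(** * Summation over all cycle covers *)

Section CoverExpansion.
Variables (T : finType) (D : {set T * T}).

Lemma sum_cycle_covers (S : finType) (Q : {set S * S}) (R : nmodType) (G : {set S * S} -> R) :
  \sum_(F | cycle_cover Q F) G F =
  \sum_(sg : {perm S} | arcs sg setT \subset Q) G (arcs sg setT).
Proof.
rewrite -[RHS]big_set -(big_imset (h := fun sg => arcs sg setT) G) /=; last first.
  by move=> s1 s2 _ _; apply: arcs_inj.
apply: eq_bigl => F; apply/cycle_coverP/imsetP => [[sg -> sQ]|[sg]].
  by exists sg; rewrite ?inE.
by rewrite inE => sQ ->; exists sg.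
Qed.

Lemma sum_path_covers_by_type (b : seq nat -> symfun) (w : {set T * T} -> int) m :
  \sum_(E | path_cover D E) w E *: b (digraph_type E) m =
  \sum_(mu <- partitions #|T|)
    (\sum_(E | path_cover D E && (digraph_type E == mu)) w E) *: b mu m.
Proof.
under [RHS]eq_bigr do rewrite scaler_suml.
rewrite (exchange_big_dep (path_cover D)) /=; last by move=> mu E _ /andP[].
apply: eq_bigr => E coverE; rewrite coverE /=.
rewrite -big_filter (perm_big [:: digraph_type E]) ?big_seq1 //.
apply: uniq_perm => // [|mu]; first exact/filter_uniq/partitions_uniq.
rewrite mem_filter inE mem_partitions eq_sym andb_idr // => /eqP ->.
exact: digraph_type_partition.
Qed.

(* The sign eps makes both bases fit: it is 1 for e and the signature of the
   permutation for h. *)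
Lemma cycle_symfun_expansion (b : seq nat -> symfun) (r : rel nat) (eps : nat -> int) m :
    (forall k, eps k * eps k = 1) ->
    (forall E, path_cover D E -> b (digraph_type E) m =
       \sum_(c : {ffun T -> 'I_m} | [forall a in E, r (c a.1) (c a.2)]) \prod_x 'X_(c x)) ->
    (forall (sg : {perm T}) (c : T -> nat), arcs sg setT \subset D ->
       \sum_(A | path_cover D (arcs sg A) && [forall a in arcs sg A, r (c a.1) (c a.2)])
         (-1) ^+ #|A| = [forall a in arcs sg setT, c a.1 == c a.2]%:R * eps #|porbits sg|) ->
  cycle_symfun D m =
  \sum_(mu <- partitions #|T|)
    (\sum_(E | path_cover D E && (digraph_type E == mu))
       (-1) ^+ #|E| *
       \sum_(tau : {perm component E} | arcs tau setT \subset quotient_digraph D E)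
          eps #|porbits tau|) *: b mu m.
Proof.
move=> eps_sq bE signed_sum; rewrite -sum_path_covers_by_type.
rewrite /cycle_symfun (sum_cycle_covers D (fun F => power_sum (digraph_type F) m)).
(* Each power sum is expanded over the path covers inside its cycle cover; [eps] moves across
   because it is its own inverse. *)
transitivity (\sum_(sg : {perm T} | arcs sg setT \subset D)
    \sum_(E | path_cover D E && (E \subset arcs sg setT))
      (eps #|porbits sg| * (-1) ^+ #|E|) *: b (digraph_type E) m).
  apply: eq_bigr => sg sD.
  under eq_bigr do rewrite -scalerA.
  rewrite -scaler_sumr -(colour_expansion sD bE (fun c => signed_sum sg c sD)).
  by rewrite scalerA eps_sq scale1r.
rewrite (exchange_big_dep (path_cover D)) /=; last by move=> ? ? _ /andP[].
(* For fixed [E], the cycle covers between [E] and [D] are counted in the quotient. *)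
apply: eq_bigr => E coverE; rewrite -scaler_suml -mulr_suml mulrC; congr (_ * _ *: _).
rewrite -(sum_extensions coverE); apply: eq_bigl => sg.
by rewrite coverE andbC.
Qed.

End CoverExpansion.

(** In the Leibniz formula only permutations whose graph lies in [Q] contribute. The enumeration of
    [S] conjugates them to permutations of ordinals, preserving the number of cycles, and the
    signature is the parity of size plus cycles. *)
Lemma det_adjacency_matrix (S : finType) (Q : {set S * S}) :
  \det (adjacency_matrix Q) =
  \sum_(tau : {perm S} | arcs tau setT \subset Q) (-1) ^+ (#|S| + #|porbits tau|).
Proof.
have f_inj (tau : {perm S}) : injective (fun i : 'I_#|S| => enum_rank (tau (enum_val i))).
  by move=> i j /enum_rank_inj/perm_inj/enum_val_inj.
have g_inj (s : 'S_#|S|) : injective (fun x : S => enum_val (s (enum_rank x))).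
  by move=> x y /enum_val_inj/perm_inj/enum_rank_inj.
pose f tau : 'S_#|S| := perm (f_inj tau).
rewrite /determinant (reindex f) /=; last first.
  exists (fun s => perm (g_inj s)) => s _; apply/permP => x; rewrite !permE.
    by rewrite enum_rankK enum_rankK.
  by rewrite enum_valK enum_valK.
rewrite [RHS]big_mkcond; apply: eq_bigr => tau _.
have -> : \prod_i adjacency_matrix Q i (f tau i) = (arcs tau setT \subset Q)%:R.
  case: (boolP (_ \subset _)) => [/subsetP sQ|/subsetPn[[x y]]].
    rewrite big1 // => i _; rewrite mxE permE enum_rankK sQ //.
    by rewrite mem_arcs inE /=.
  rewrite mem_arcs inE => /eqP -> xQ; rewrite (bigD1 (enum_rank x)) //=.
  by rewrite mxE permE !enum_rankK (negPf xQ) mul0r.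
case: ifP => _; rewrite ?mulr0 // mulr1.
have fX k i : (f tau ^+ k)%g i = enum_rank ((tau ^+ k)%g (enum_val i)).
  elim: k => [|k IH]; first by rewrite !expg0 !perm1 enum_valK.
  by rewrite !expgSr !permM IH permE enum_rankK.
have -> : #|porbits tau| = #|porbits (f tau)|.
  have -> : porbits tau = [set porbit tau (enum_val i) | i : 'I_#|S|].
    apply/setP => O; apply/imsetP/imsetP => -[x _ ->]; last by exists (enum_val x).
    by exists (enum_rank x); rewrite ?enum_rankK.
  apply: card_imset_same_kernel => i j; split=> /eqP; rewrite eq_porbit_mem.
    case/porbitP => k eq_i; apply/eqP; rewrite eq_porbit_mem; apply/porbitP.
    by exists k; rewrite fX -eq_i enum_valK.
  case/porbitP => k eq_i; apply/eqP; rewrite eq_porbit_mem; apply/porbitP.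
  by exists k; rewrite eq_i fX enum_rankK.
by rewrite -[RHS]signr_odd oddD /odd_perm card_ord.
Qed.

Lemma num_path_cycle_coversE (T : finType) (D : {set T * T}) lam :
  (num_path_cycle_covers D lam)%:Z =
  \sum_(E | path_cover D E && (digraph_type E == lam))
    \sum_(tau : {perm component E} | arcs tau setT \subset quotient_digraph D E) 1.
Proof.
under eq_bigr do rewrite -(sum_cycle_covers _ (fun=> 1)).
rewrite sig_big_dep /num_path_cycle_covers -natz -sum1_card natr_sum.
by apply: eq_bigl => EF; rewrite inE andbA.
Qed.

Theorem theorem3p3 (T : finType) (D : {set T * T}) (n : nat) (hn : #|T| = n)
    (lam : seq nat) (hlam : is_partition_of n lam) :
  is_coefficient n
    (fun mu m => (-1) ^+ (n - size mu)%N *: elementary mu m)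
    (cycle_symfun D) lam
    (num_path_cycle_covers D lam)%:Z
  /\
  is_coefficient n complete_homogeneous (cycle_symfun D) lam
    (\sum_(E : {set T * T} | path_cover D E && (digraph_type E == lam))
        \det (adjacency_matrix (quotient_digraph D E))).
Proof.
subst n; split.
  apply: (is_coefficientP (a := fun mu => (num_path_cycle_covers D mu)%:Z)) => //.
    exact: elementary_free.
  move=> m; rewrite (@cycle_symfun_expansion _ _ elementary ltn (fun=> 1)) //.
  - apply: eq_bigr => mu _; rewrite scalerA num_path_cycle_coversE mulr_suml.
    congr (_ *: _); apply: eq_bigr => E /andP[coverE /eqP <-].
    (* The number of arcs of [E] is [n] minus its number of paths, so the two signs agree. *)
    by rewrite mulrC -(card_path_cover coverE) size_digraph_type addnK.
  - by move=> E coverE; apply: elementary_colourings coverE.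
  - by move=> sg c sD; rewrite mulr1 (signed_sum_strict_ascents c sD).
apply: (is_coefficientP (a := fun mu =>
    \sum_(E | path_cover D E && (digraph_type E == mu))
      \det (adjacency_matrix (quotient_digraph D E)))) => //.
  exact: complete_homogeneous_free.
move=> m; rewrite (@cycle_symfun_expansion _ _ complete_homogeneous leq
                     (fun k => (-1) ^+ (#|T| + k))).
- apply: eq_bigr => mu _; congr (_ *: _); apply: eq_bigr => E /andP[coverE _].
  rewrite det_adjacency_matrix mulr_sumr; apply: eq_bigr => tau _.
  have card_comp : #|component E| = #|components E|.
    by rewrite card_sig; apply: eq_card.
  (* With [n] equal to arcs plus paths, the arcs are counted twice in the exponent, leaving the
     signature of [tau] on the set of paths. *)
  rewrite card_comp -(card_path_cover coverE) -exprD -!addnA addnA addnn.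
  by rewrite -[LHS]signr_odd oddD odd_double signr_odd.
- by move=> k; rewrite -exprD addnn -signr_odd odd_double.
- by move=> E coverE; apply: complete_homogeneous_colourings coverE.
- by move=> sg c sD; rewrite (signed_sum_weak_ascents c sD).
Qed.
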